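(* Let $J$ be a non-infinitesimal interval of ${}^\bullet\mathbb{R}$ and let $f,g:J\to{}^\bullet\mathbb{R}$ be smooth functions. Let $a,b\in J$ with $a<b$. If $|f(x)|\le g(x)$ for all $x\in[a,b]$, then $\left|\int_a^b f\right|\le\int_a^b g$.
   Context: Fermat reals: let $\mathbb{R}_o[t]$ be the set of maps $x:\mathbb{R}_{\ge0}\to\mathbb{R}$, $t\mapsto x_t$, of the form $x_t=r+\sum_{i=1}^k\alpha_i t^{a_i}+o(t)$ as $t\to0^+$, with $k\in\mathbb{N}$, $r,\alpha_i\in\mathbb{R}$, $a_i\in\mathbb{R}_{\ge0}$. Write $x\sim y$ iff $x_t=y_t+o(t)$ as $t\to0^+$. The ring of Fermat reals is ${}^\bullet\mathbb{R}:=\mathbb{R}_o[t]/\sim$ with pointwise operations; $\mathbb{R}\subseteq{}^\bullet\mathbb{R}$ via constants. The standard part of $x=[x_t]$ is ${}^\circ x:=x_0$. ${}^\bullet\mathbb{R}$ is totally ordered by: $x\le y$ iff for representatives there is $z\in\mathbb{R}_o[t]$ with $z\sim0$ and $x_t\le y_t+z_t$ for all small $t\ge0$; $|x|:=x$ if $x\ge0$ and $|x|:=-x$ otherwise; $[a,b]:=\{x\in{}^\bullet\mathbb{R}:a\le x\le b\}$. $\overline{{}^\bullet\mathbb{R}}:={}^\bullet\mathbb{R}\cup\{\pm\infty\}$, ${}^\circ(\pm\infty):=\pm\infty$. An interval is a set $[a,b],(a,b),[a,b),(a,b]$ of points of ${}^\bullet\mathbb{R}$ with $a\le b$ in $\overline{{}^\bullet\mathbb{R}}$;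 non-infinitesimal if ${}^\circ a<{}^\circ b$. The Fermat topology on ${}^\bullet\mathbb{R}^n$ has open sets ${}^\bullet V:=\{x:{}^\circ x\in V\}$, $V\subseteq\mathbb{R}^n$ open. For $\alpha\in C^\infty(W,\mathbb{R}^m)$, $W\subseteq\mathbb{R}^d$ open, ${}^\bullet\alpha([x_t]):=[\alpha(x_t)]$. A map $f:S\to{}^\bullet\mathbb{R}^m$, $S\subseteq{}^\bullet\mathbb{R}^n$, is smooth if for every $x\in S$ there exist open $V\subseteq\mathbb{R}^n$ with $x\in{}^\bullet V$, open $P\subseteq\mathbb{R}^{\mathsf p}$, $p\in{}^\bullet P$, $\alpha\in C^\infty(P\times V,\mathbb{R}^m)$ with $f(y)={}^\bullet\alpha(p,y)$ for $y\in{}^\bullet V\cap S$. For $g$ smooth on a non-infinitesimal interval $J$ and $x\in J$, $g'(x):={}^\bullet(\partial_2\alpha)(p,x)$ for any local representation of $g$ around $x$ (independent of it). Integral: for a non-infinitesimal interval $J$, smooth $f:J\to{}^\bullet\mathbb{R}$ and $u\in J$, $\int_u^{(-)}f$ is the unique smooth $I:J\to{}^\bullet\mathbb{R}$ with $I(u)=0$ and $I'(x)=f(x)$ for all $x\in J$, and $\int_u^v f:=I(v)$ for $v\in J$. *)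

(* Defs.v *)
From HB Require Import structures.
From mathcomp Require Import all_boot all_order all_algebra.
From mathcomp Require Import all_classical all_reals all_analysis.
Set Implicit Arguments. Unset Strict Implicit. Unset Printing Implicit Defensive.
Import Order.TTheory GRing.Theory Num.Theory.
Import numFieldNormedType.Exports.
Local Open Scope classical_set_scope.
Local Open Scope ring_scope.

Section Fermat.
Variable R : realType.

Definition choose_or (T : Type) (d : T) (P : T -> Prop) : T :=
  match pselect (exists x, P x) with
  | left h => proj1_sig (cid h)
  | right _ => d
  end.

Definition littleo_t (w : R -> R) : Prop :=
  w 0 = 0 /\ (fun t => w t / t) @ 0^'+ --> (0 : R).

(* little-oh polynomials R_o[t]; only values at t >= 0 matter *)
Definition Rot (x : R -> R) : Prop :=
  exists (r : R) (k : nat) (al aa : 'I_k -> R) (w : R -> R),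
    (forall i, 0 <= aa i) /\ littleo_t w /\
    forall t, 0 <= t -> x t = r + \sum_(i < k) al i * t `^ (aa i) + w t.

Definition simt (x y : R -> R) : Prop := littleo_t (fun t => x t - y t).

Definition cls (x : R -> R) : set (R -> R) := [set y | Rot y /\ simt x y].

Definition FR : Type := {S : set (R -> R) | exists x, Rot x /\ S = cls x}.

Lemma Rot0 : Rot (fun _ => 0).
Proof.
exists 0, 0%N, (fun _ => 0), (fun _ => 0), (fun _ => 0); split; [by []|split].
- split; first by [].
  by apply: cvg_near_cst; near=> t; rewrite mul0r.
- by move=> t _; rewrite big_ord0 !addr0.
Unshelve. all: by end_near.
Qed.

Definition FR0 : FR := exist _ (cls (fun _ => 0)) (ex_intro _ _ (conj Rot0 erefl)).

(* class [x] of a map x (junk value 0 if x is not in R_o[t]) *)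
Definition mkFR (x : R -> R) : FR :=
  match pselect (Rot x) with
  | left h => exist _ (cls x) (ex_intro _ x (conj h erefl))
  | right _ => FR0
  end.

Definition rep (X : FR) : R -> R := proj1_sig (cid (proj2_sig X)).

Definition std (X : FR) : R := rep X 0.

Definition FRle (X Y : FR) : Prop :=
  exists z : R -> R, Rot z /\ simt z (fun _ => 0) /\
    exists d : R, 0 < d /\ forall t, 0 <= t < d -> rep X t <= rep Y t + z t.

Definition FRlt (X Y : FR) : Prop := FRle X Y /\ X <> Y.

Definition FRopp (X : FR) : FR := mkFR (fun t => - rep X t).

Definition FRabs (X : FR) : FR :=
  if pselect (FRle FR0 X) then X else FRopp X.

Inductive eFR := Fin of FR | PInf | NInf.

Definition eFRle (a b : eFR) : Prop :=
  match a, b with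
  | NInf, _ => True
  | _, PInf => True
  | Fin x, Fin y => FRle x y
  | _, _ => False
  end.

Definition eFRlt (a b : eFR) : Prop := eFRle a b /\ a <> b.

Definition estd (a : eFR) : \bar R :=
  match a with Fin x => (std x)%:E | PInf => +oo%E | NInf => -oo%E end.

Inductive ikind := Icc | Ioo | Ico | Ioc.

Definition interval_set (k : ikind) (a b : eFR) : set FR :=
  [set x | match k with
           | Icc => eFRle a (Fin x) /\ eFRle (Fin x) b
           | Ioo => eFRlt a (Fin x) /\ eFRlt (Fin x) b
           | Ico => eFRle a (Fin x) /\ eFRlt (Fin x) b
           | Ioc => eFRlt a (Fin x) /\ eFRle (Fin x) b
           end].

Definition nonInf_interval (J : set FR) : Prop :=
  exists (k : ikind) (a b : eFR),
    eFRle a b /\ (estd a < estd b)%E /\ J = interval_set k a b.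

Definition FRcc (a b : FR) : set FR := [set x | FRle a x /\ FRle x b].

(* C^k / C^oo on an open subset of a normed space, via iterated directional
   derivatives (equivalent to the usual definition in finite dimension). *)
Fixpoint Ck (V : normedModType R) (k : nat) (W : set V) (f : V -> R) : Prop :=
  (forall x, W x -> {for x, continuous f}) /\
  match k with
  | 0%N => True
  | k'.+1 => (forall x v, W x -> derivable f x v) /\
             (forall v, Ck k' W (fun x => 'D_v f x))
  end.

Definition Cinf (V : normedModType R) (W : set V) (f : V -> R) : Prop :=
  forall k, Ck k W f.

Definition ext (d : nat) (al : 'rV[R]_d -> R -> R) (p : 'I_d -> FR) (y : FR) : FR :=
  mkFR (fun t => al (\row_i rep (p i) t) (rep y t)).

Definition std_vec (d : nat) (p : 'I_d -> FR) : 'rV[R]_d := \row_i std (p i).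

Definition local_rep (S : set FR) (f : FR -> FR) (x : FR)
  (V : set R) (d : nat) (P : set 'rV[R]_d) (p : 'I_d -> FR)
  (al : 'rV[R]_d -> R -> R) : Prop :=
  open V /\ V (std x) /\ open P /\ P (std_vec p) /\
  Cinf (P `*` V) (fun z : 'rV[R]_d * R => al z.1 z.2) /\
  forall y, V (std y) -> S y -> f y = ext al p y.

Definition FRsmooth (S : set FR) (f : FR -> FR) : Prop :=
  forall x, S x -> exists V d P p al, @local_rep S f x V d P p al.

Definition FRderiv_is (J : set FR) (g : FR -> FR) (x z : FR) : Prop :=
  exists V d P p al, @local_rep J g x V d P p al /\
    z = ext (fun q y => derive1 (al q) y) p x.

Definition is_primitive (J : set FR) (f : FR -> FR) (u : FR) (I : FR -> FR) : Prop :=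
  FRsmooth J I /\ I u = FR0 /\ forall x, J x -> FRderiv_is J I x (f x).

(* int_u^v f := I(v), I the (unique) primitive *)
Definition FRintegral (J : set FR) (f : FR -> FR) (u v : FR) : FR :=
  choose_or (fun _ => FR0) (is_primitive J f u) v.

End Fermat.

(* Main.v *)
Require Import Defs.
From HB Require Import structures.
From mathcomp Require Import all_boot all_order all_algebra.
From mathcomp Require Import all_classical all_reals all_analysis.
From mathcomp Require Import ring lra.
(* The idea is that differentiation of Fermat-smooth functions can be read off real
   coefficient functions. Taylor expansion in the parameters (which needs the symmetry of
   second derivatives) shows that a smooth function is locally of the form
   y |-> sum_e t^e u_e(y_t) + o(t), a finite sum with smooth u_e of one real variable,
   and that its derivative is then sum_e t^e u_e'(y_t) + o(t). Along the segment
   s |-> a + s (b - a), s a real number in [0, 1], expanding once more in t gives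
   sum_e c_e(s) t^e + o(t), where for e <= 1 the c_e(s) are determined by the function, so
   that the sign of the derivative is a lexicographic condition on the c_e'(s). If this is
   nonnegative, then the first c_e that is not constant is nondecreasing, by induction on
   the exponent; hence functions with ordered derivatives have ordered increments. This
   yields the inequality, and also the uniqueness of primitives, by which the local
   primitives obtained by integrating the u_e are glued into a global one. The latter is
   needed since the integral has a junk value when no primitive exists. *)

Set Implicit Arguments. Unset Strict Implicit. Unset Printing Implicit Defensive.
Import Order.TTheory GRing.Theory Num.Theory.
Import numFieldNormedType.Exports.
Local Open Scope classical_set_scope.
Local Open Scope ring_scope.

(** * Functions of class C^k *)

(** An inequality between Fermat reals cannot simply be integrated on representatives: at each point
    X the relation f(X) <= g(X) holds up to some o(t) and for t below some bound, and both depend on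
    X without any uniformity. Hence the passage to finitely many real coefficients, for which the
    sign condition at a single s is exact. Standard parts are too coarse, since b - a may be
    infinitesimal; s |-> a + s (b - a) parametrises such segments by real numbers too, at the price
    of the factor b - a >= 0 in the derivative. Powers t^e with e > 1 are o(t), so only exponents up
    to 1 carry information; the Taylor expansion in a displacement c t^a stops at the first order N
    with a N > 1, which keeps all sums finite. The expansion changes from point to point of the
    segment, and two expansions agree on their common domain only modulo o(t); the sign condition is
    carried from one to the other by uniqueness of the coefficients up to 1, and the local
    comparisons are chained by a supremum argument on [0, 1]. *)

Section CkTheory.
Variables (R : realType) (V : normedModType R).
Implicit Types (W : set V) (f g : V -> R).

Lemma Ck_cont k W f x : Ck k W f -> W x -> {for x, continuous f}.
Proof. by case: k => [|k] [+ _] => /[apply]. Qed.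

Lemma CkS k W f : Ck k.+1 W f -> Ck k W f.
Proof.
elim: k f => [|k IH] f [cf [df Df]]; first by split.
by split=> //; split=> // v; apply: IH.
Qed.

Lemma Ck_ext k W f g : open W -> (forall x, W x -> f x = g x) ->
  Ck k W f -> Ck k W g.
Proof.
move=> oW; elim: k f g => [|k IH] f g fg.
  case=> cf _; split=> // x Wx; rewrite /prop_for /continuous_at -fg//.
  apply: cvg_trans (cf x Wx); apply: near_eq_cvg.
  by near=> y; apply/fg; near: y; exact: open_nbhs_nbhs.
case=> cf [df Df].
have nfg x : W x -> {near x, f =1 g}.
  by move=> Wx; near=> y; apply/fg; near: y; exact: open_nbhs_nbhs.
have Dfg x v : W x -> 'D_v f x = 'D_v g x.
  move=> Wx; have [->|v0] := eqVneq v 0; first by rewrite !derive0.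
  exact: near_eq_derive (nfg x Wx).
split; last split.
- move=> x Wx; rewrite /prop_for /continuous_at -fg//.
  by apply: cvg_trans (cf x Wx); apply: near_eq_cvg; exact: nfg.
- move=> x v Wx; have [->|v0] := eqVneq v 0; first exact: derivable0.
  exact: near_eq_derivable (nfg x Wx) (df x v Wx).
- by move=> v; apply: IH (Df v) => x Wx; exact: Dfg.
Unshelve. all: by end_near.
Qed.

Lemma Ck_cst k W (c : R) : open W -> Ck k W (fun=> c).
Proof.
move=> oW; elim: k c => [|k IH] c; first by split=> // x _; exact: cvg_cst.
split; first by move=> x _; exact: cvg_cst.
split; first by move=> x v _; exact: derivable_cst.
by move=> v; apply: Ck_ext (IH 0) => // x _; rewrite derive_cst.
Qed.

Lemma is_derive_linear f (x v : V) :
  (forall a x y, f (a *: x + y) = a * f x + f y) -> is_derive x v f (f v).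
Proof.
move=> lf.
have q : (fun h : R => h^-1 *: ((f \o shift x) (h *: v) - f x)) @ 0^' --> f v.
  apply: cvg_near_cst; near=> h; rewrite /= lf addrK -[_ *: _]/(_ * _) mulKf//.
  by near: h; exact: nbhs_dnbhs_neq.
split; first by apply/cvg_ex; exists (f v).
by apply: cvg_lim; first exact: Rhausdorff.
Unshelve. all: by end_near. Qed.

Lemma Ck_linear k W f : open W -> continuous f ->
  (forall a x y, f (a *: x + y) = a * f x + f y) -> Ck k W f.
Proof.
move=> oW cf lf; case: k => [|k]; first by split=> // x _; exact: cf.
split; first by move=> x _; exact: cf.
split=> [x v _|v]; first by have [] := is_derive_linear x v lf.
apply: Ck_ext (Ck_cst k (f v) oW) => // x _.
by have [_ ->] := is_derive_linear x v lf.
Qed.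

Lemma CkD k W f g : open W -> Ck k W f -> Ck k W g -> Ck k W (fun x => f x + g x).
Proof.
move=> oW; elim: k f g => [|k IH] f g.
  by move=> [cf _] [cg _]; split=> // x Wx; apply: cvgD; [exact: cf|exact: cg].
move=> [cf [df Df]] [cg [dg Dg]]; split.
  by move=> x Wx; apply: cvgD; [exact: cf|exact: cg].
split=> [x v Wx|v]; first by apply: derivableD; [exact: df|exact: dg].
apply: Ck_ext (IH _ _ (Df v) (Dg v)) => // x Wx.
by rewrite -deriveD//; [exact: df|exact: dg].
Qed.

Lemma CkM k W f g : open W -> Ck k W f -> Ck k W g -> Ck k W (fun x => f x * g x).
Proof.
move=> oW; elim: k f g => [|k IH] f g.
  by move=> [cf _] [cg _]; split=> // x Wx; apply: cvgM; [exact: cf|exact: cg].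
move=> Cf Cg; have := Cf; have := Cg; move=> [cg [dg Dg]] [cf [df Df]]; split.
  by move=> x Wx; apply: cvgM; [exact: cf|exact: cg].
split=> [x v Wx|v]; first by apply: derivableM; [exact: df|exact: dg].
apply: (Ck_ext oW); last exact: (CkD oW (IH _ _ (CkS Cf) (Dg v)) (IH _ _ (CkS Cg) (Df v))).
move=> x Wx; rewrite (_ : (fun x => f x * g x) = f * g)// deriveM//;
  [exact: df|exact: dg].
Qed.

(** Restriction to a line turns a directional derivative into an ordinary one. The mean value
    theorem, the chain rule and Taylor's formula reach functions on [V] in this way. *)
Lemma line_quotient f (x v : V) (h : R) :
  (fun k : R => k^-1 *: ((f \o shift (x + h *: v)) (k *: v) - f (x + h *: v)))
  = (fun k : R => k^-1 *: (((fun h : R => f (x + h *: v)) \o shift h) (k *: 1)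
      - f (x + h *: v))).
Proof.
by apply/funext => k /=; rewrite -[k *: 1]/(k * 1) mulr1 scalerDl addrCA.
Qed.

Lemma derive_line f (x v : V) (h : R) :
  'D_v f (x + h *: v) = 'D_1 (fun h : R => f (x + h *: v)) h.
Proof. by rewrite /derive line_quotient. Qed.

Lemma derivable_line f (x v : V) (h : R) : derivable f (x + h *: v) v ->
  derivable (fun h : R => f (x + h *: v)) h 1.
Proof. by rewrite /derivable line_quotient. Qed.

Lemma is_derive_line f (x v : V) (h : R) : derivable f (x + h *: v) v ->
  is_derive h (1 : R) (fun h : R => f (x + h *: v)) ('D_v f (x + h *: v)).
Proof.
move=> /derivable_line d; split => //.
by rewrite derive_line.
Qed.

Lemma Cinf_ext W f g : open W -> (forall x, W x -> f x = g x) -> Cinf W f -> Cinf W g.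
Proof. by move=> oW fg Cf k; exact: Ck_ext (Cf k). Qed.

Lemma CinfD W f g : open W -> Cinf W f -> Cinf W g -> Cinf W (fun x => f x + g x).
Proof. by move=> oW Cf Cg k; exact: CkD. Qed.

Lemma CinfM W f g : open W -> Cinf W f -> Cinf W g -> Cinf W (fun x => f x * g x).
Proof. by move=> oW Cf Cg k; exact: CkM. Qed.

Lemma Cinf_cst W (c : R) : open W -> Cinf W (fun=> c).
Proof. by move=> oW k; exact: Ck_cst. Qed.

Lemma Cinf_linear W f : open W -> continuous f ->
  (forall a x y, f (a *: x + y) = a * f x + f y) -> Cinf W f.
Proof. by move=> oW cf lf k; exact: Ck_linear. Qed.

Lemma Cinf_sum (I : Type) (s : seq I) (f : I -> V -> R) W : open W ->
  (forall i, Cinf W (f i)) -> Cinf W (fun x => \sum_(i <- s) f i x).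
Proof.
move=> oW Cf; elim: s => [|i s IH].
  by apply: Cinf_ext (Cinf_cst 0 oW) => // x _; rewrite big_nil.
by apply: Cinf_ext (CinfD oW (Cf i) IH) => // x _; rewrite big_cons.
Qed.

Lemma Cinf_cont W f x : Cinf W f -> W x -> {for x, continuous f}.
Proof. by move=> /(_ 0%N) C Wx; exact: (Ck_cont C Wx). Qed.

Lemma Cinf_derivable W f x v : Cinf W f -> W x -> derivable f x v.
Proof. by move=> /(_ 1%N)[_ [d _]] Wx; exact: d. Qed.

Lemma Cinf_derive W f v : Cinf W f -> Cinf W (fun x => 'D_v f x).
Proof. by move=> Cf k; have [_ [_ D]] := Cf k.+1; exact: D. Qed.

Lemma Cinf_sub W W' f : W' `<=` W -> Cinf W f -> Cinf W' f.
Proof.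
move=> sW Cf k; have := Cf k; elim: k f {Cf} => [|k IH] f.
  by case=> cf _; split=> // x /sW; exact: cf.
case=> cf [df Df]; split; first by move=> x /sW; exact: cf.
by split=> [x v /sW Wx|v]; [exact: df|apply: IH; exact: Df].
Qed.

End CkTheory.

(** Induction on the order for all [u] at once: the derivative in direction [v] is
    ['D_1 u (f x) * 'D_v f x], whose first factor is again a composition, with ['D_1 u] in place of
    [u]. The chain rule itself is applied on the line through [x]. *)
Lemma Cinf_comp (R : realType) (V : normedModType R) (W : set V) (U : set R) (u : R -> R)
  (f : V -> R) : open W ->
  (forall x, W x -> U (f x)) -> Cinf U u -> Cinf W f -> Cinf W (fun x => u (f x)).
Proof.
move=> oW WU Cu Cf k; elim: k u Cu => [|k IH] u Cu.
  split=> // x Wx; apply: continuous_comp; first exact: Cinf_cont Wx.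
  by exact: (Cinf_cont Cu (WU _ Wx)).
have D x v : W x -> is_derive x v (fun x => u (f x)) ('D_(1 : R) u (f x) * 'D_v f x).
  move=> Wx.
  have := @is_derive_line _ _ f x v 0; rewrite scale0r addr0.
  move=> /(_ (Cinf_derivable Cf Wx)) L.
  have Lu : is_derive (f (x + 0 *: v)) (1 : R) u ('D_(1 : R) u (f x)).
    rewrite scale0r addr0; apply/derivableP.
    exact: (Cinf_derivable Cu (WU _ Wx)).
  have L2 : is_derive (0 : R) (1 : R) (fun h : R => u (f (x + h *: v))) ('D_(1 : R) u (f x) * 'D_v f x).
    exact: (@is_derive1_comp R u (fun h => f (x + h *: v)) 0).
  have := line_quotient (fun x => u (f x)) x v 0; rewrite scale0r addr0 => e.
  have [L3 L4] := L2.
  split; first by rewrite /derivable e; move: L3; rewrite /derivable scale0r addr0.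
  by rewrite /derive e; move: L4; rewrite /derive scale0r addr0.
split.
  move=> x Wx; apply: continuous_comp; first exact: Cinf_cont Wx.
  by exact: (Cinf_cont Cu (WU _ Wx)).
split=> [x v Wx|v]; first by have [] := D x v Wx.
have C1 : Ck k W (fun x => 'D_(1 : R) u (f x)) by exact: (IH ('D_(1 : R) u) (Cinf_derive (1 : R) Cu)).
have C2 := CkM oW C1 (Cinf_derive v Cf k).
by refine (Ck_ext oW _ C2) => x Wx; have [_ ->] := D x v Wx.
Qed.

(** * Symmetry of second derivatives and Taylor's formula *)

Section MeanValue.
Variables (R : realType) (V : normedModType R).
Implicit Types (W : set V) (f g : V -> R).

(** The intermediate point is controlled by its absolute value only, so that one statement covers
    both signs of [x]. *)
Lemma MVT_sym (f df : R -> R) (x : R) :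
  (forall t : R, `|t| <= `|x| -> is_derive t (1 : R) f (df t)) ->
  exists2 c, `|c| <= `|x| & f x - f 0 = df c * x.
Proof.
move=> d.
have cont (a b : R) : (forall t : R, t \in `[a, b] -> is_derive t (1 : R) f (df t)) ->
    {within `[a, b], continuous f}.
  move=> dd; apply: derivable_within_continuous => t tab.
  by have [] := dd t tab.
have [x0|x0] := leP 0 x.
  have dd (t : R) : t \in `[0, x] -> is_derive t (1 : R) f (df t).
    by rewrite in_itv/= => /andP[t0 tx]; apply: d; rewrite !ger0_norm.
  have cc := cont 0 x dd.
  have mm := @MVT_segment R f df 0 x x0.
  have dd' : forall t : R, t \in `]0, x[ -> is_derive t 1 f (df t).
    by move=> t /subset_itv_oo_cc; exact: dd.
  have [c] := mm dd' cc.
  rewrite in_itv/= subr0 => /andP[c0 cx] e; exists c => //.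
  by rewrite !ger0_norm.
have dd (t : R) : t \in `[x, 0] -> is_derive t (1 : R) f (df t).
  by rewrite in_itv/= => /andP[t0 tx]; apply: d; rewrite !ler0_norm ?lerN2// ltW.
have cc := cont x 0 dd.
have mm := @MVT_segment R f df x 0 (ltW x0).
have dd' : forall t : R, t \in `]x, 0[ -> is_derive t 1 f (df t).
  by move=> t /subset_itv_oo_cc; exact: dd.
have [c] := mm dd' cc.
rewrite in_itv/= sub0r => /andP[c0 cx] e; exists c => //.
  by rewrite !ler0_norm ?lerN2// ltW.
by rewrite -opprB e mulrN opprK.
Qed.

Lemma MVT_line f (x v : V) (h : R) :
  (forall t, `|t| <= `|h| -> derivable f (x + t *: v) v) ->
  exists2 c, `|c| <= `|h| & f (x + h *: v) - f x = 'D_v f (x + c *: v) * h.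
Proof.
move=> d.
have [|c ch e] := @MVT_sym (fun t : R => f (x + t *: v)) (fun t : R => 'D_v f (x + t *: v)) h.
  by move=> t /d; exact: is_derive_line.
by exists c => //; rewrite -e scale0r addr0.
Qed.

(** Mean value theorem in direction [u] for the difference [phi] of two parallel lines, then in
    direction [v] for ['D_u f]. The left side is symmetric in [u] and [v], which is what makes the
    mixed derivatives comparable. *)
Lemma second_difference f (x u v : V) (h r : R) (W : set V) :
  open W -> Cinf W f -> (forall y, `|y - x| < r -> W y) ->
  0 <= h -> h * (`|u| + `|v|) < r ->
  exists2 y, `|y - x| < r &
    f (x + h *: u + h *: v) - f (x + h *: u) - f (x + h *: v) + f x =
    'D_v ('D_u f) y * h ^+ 2.
Proof.
move=> oW Cf Wr h0 hr.
have inW s t : `|s| <= h -> `|t| <= h -> `|x + s *: u + t *: v - x| < r.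
  move=> sh th; apply: le_lt_trans hr.
  rewrite addrC -!addrA addKr mulrDr (le_trans (ler_normD _ _))//.
  by rewrite !normrZ lerD// ler_wpM2r.
have inW0 s : `|s| <= h -> `|x + s *: u - x| < r.
  by move=> sh; have := inW s 0 sh; rewrite scale0r addr0; apply; rewrite normr0.
have hh : `|h| = h by rewrite ger0_norm.
pose phi (s : R) := f (x + h *: v + s *: u) - f (x + s *: u).
have [|c ch ec] := @MVT_sym phi
    (fun s : R => 'D_u f (x + h *: v + s *: u) - 'D_u f (x + s *: u)) h.
  move=> t th; rewrite hh in th.
  have d1 : is_derive t (1 : R) (fun s : R => f (x + h *: v + s *: u)) ('D_u f (x + h *: v + t *: u)).
    apply: is_derive_line; apply: (Cinf_derivable Cf); apply: Wr.
    by rewrite (addrAC x); apply: inW => //; rewrite hh.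
  have d2 : is_derive t (1 : R) (fun s : R => f (x + s *: u)) ('D_u f (x + t *: u)).
    apply: is_derive_line; apply: (Cinf_derivable Cf); apply: Wr.
    exact: inW0.
  exact: is_deriveB.
rewrite hh in ch.
have [|d dh ed] := @MVT_line ('D_u f) (x + c *: u) v h.
  move=> t th; rewrite hh in th; apply: (Cinf_derivable (Cinf_derive u Cf)).
  by apply: Wr; exact: inW.
rewrite hh in dh.
exists (x + c *: u + d *: v); first exact: inW.
rewrite expr2 mulrA -ed (addrAC x (c *: u)) -ec /phi scale0r !addr0.
by rewrite (addrAC x (h *: v)); ring.
Qed.

Lemma Schwarz W f (x u v : V) : open W -> Cinf W f -> W x ->
  'D_u ('D_v f) x = 'D_v ('D_u f) x.
Proof.
move=> oW Cf Wx; apply/eqP; rewrite -subr_eq0 -normr_le0; apply/ler_addgt0Pl => e e0.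
rewrite addr0.
have e2 : 0 < e / 2 by rewrite divr_gt0.
have c1 := Cinf_cont (Cinf_derive u (Cinf_derive v Cf)) Wx.
have c2 := Cinf_cont (Cinf_derive v (Cinf_derive u Cf)) Wx.
have : \forall y \near x, W y /\ `|'D_u ('D_v f) x - 'D_u ('D_v f) y| < e / 2 /\
     `|'D_v ('D_u f) x - 'D_v ('D_u f) y| < e / 2.
  have n0 : \forall y \near x, W y by exact: open_nbhs_nbhs.
  have n1 : \forall y \near x, `|'D_u ('D_v f) x - 'D_u ('D_v f) y| < e / 2.
    by move/cvgr_dist_lt: c1; apply.
  have n2 : \forall y \near x, `|'D_v ('D_u f) x - 'D_v ('D_u f) y| < e / 2.
    by move/cvgr_dist_lt: c2; apply.
  exact: filterS3 (fun y a b c => conj a (conj b c)) n0 n1 n2.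
case/nbhs_ballP => r /= r0 br.
have {}br y : `|y - x| < r -> W y /\ `|'D_u ('D_v f) x - 'D_u ('D_v f) y| < e / 2 /\
     `|'D_v ('D_u f) x - 'D_v ('D_u f) y| < e / 2.
  by move=> yx; apply: br; rewrite -ball_normE/= distrC.
(* The summand 1 avoids division by 0 when [u] and [v] vanish; the final factor 1/2 makes the bound
   by [r] strict. *)
pose h := r / (`|u| + `|v| + 1) / 2.
have s0 : 0 < `|u| + `|v| + 1 by rewrite ltr_wpDl// addr_ge0.
have h0 : 0 < h by rewrite !divr_gt0.
have hr : h * (`|u| + `|v|) < r.
  have : h * (`|u| + `|v| + 1) < r by rewrite /h mulrAC divfK ?gt_eqF// ltr_pdivrMr// ltr_pMr// ltr1n.
  by apply: le_lt_trans; rewrite ler_wpM2l ?ltW// ltrDl.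
have hr' : h * (`|v| + `|u|) < r by rewrite addrC.
have Wr y : `|y - x| < r -> W y by move=> /br[].
have [y1 /br[_ [_ b1]] e1] := second_difference oW Cf Wr (ltW h0) hr.
have [y2 /br[_ [b2 _]] e3] := second_difference oW Cf Wr (ltW h0) hr'.
(* Both mixed derivatives, taken at different points close to [x], arise from the same second
   difference divided by [h ^+ 2]. *)
have : 'D_u ('D_v f) y2 = 'D_v ('D_u f) y1.
  apply: (@mulIf _ (h ^+ 2)); first by rewrite expf_neq0// gt_eqF.
  apply: (etrans (esym e3)); apply: (etrans _ e1).
  by rewrite (addrAC x (h *: v)); ring.
move=> ey; suff aux (a b c d : R) :
  `|a - c| < e / 2 -> `|b - d| < e / 2 -> c = d -> `|a - b| <= e by exact: aux b2 b1 ey.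
move=> h1 h2 cd; rewrite [e]splitr (_ : a - b = (a - c) + (d - b)); last by rewrite cd; ring.
apply: (le_trans (ler_normD _ _)); apply: lerD; first exact: ltW.
by rewrite distrC; exact: ltW.
Qed.

End MeanValue.

Section Taylor.
Variable R : realType.

Lemma is_derive_poly_fact (c : nat -> R) (N : nat) (x : R) :
  is_derive x (1 : R) (fun t : R => \sum_(k < N.+1) c k * t ^+ k / k`!%:R)
    (\sum_(k < N) c k.+1 * x ^+ k / k`!%:R).
Proof.
elim: N => [|N IH].
  rewrite big_ord0 (_ : (fun _ => _) = cst (c 0%N)); first exact: is_derive_cst.
  by apply/funext => t; rewrite big_ord1 expr0 fact0 invr1 !mulr1.
rewrite big_ord_recr/= (_ : (fun _ => _) =
   (fun t : R => \sum_(k < N.+1) c k * t ^+ k / k`!%:R) +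
   ((c N.+1 / (N.+1)`!%:R) \*: (@id R) ^+ N.+1)); last first.
  apply/funext => t; rewrite big_ord_recr/=; congr (_ + _).
  by rewrite exprfctE -[RHS]/(_ * _) mulrAC.
apply: is_deriveD; apply: is_derive_eq.
rewrite -[LHS]/(_ * (_ * _)) mulr1 factS natrM.
have f0 : (N`!)%:R != 0 :> R by rewrite pnatr_eq0 -lt0n fact_gt0.
have n0 : (N.+1)%:R != 0 :> R by rewrite pnatr_eq0.
by field; rewrite f0/=.
Qed.

(** [phi k] stands for the k-th derivative. The remainder of [phi 0] vanishes at 0 and its
    derivative is the remainder of [phi 1], so each mean value step gains one factor [|t|]. The
    factor 1/N! is given up, since only the order in [t] matters. *)
Lemma Taylor_bound (phi : nat -> R -> R) (N : nat) (rho M : R) :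
  (forall k t, `|t| <= rho -> is_derive t (1 : R) (phi k) (phi k.+1 t)) ->
  (forall t, `|t| <= rho -> `|phi N t| <= M) ->
  forall t, `|t| <= rho ->
    `|phi 0%N t - \sum_(k < N) phi k 0 * t ^+ k / k`!%:R| <= M * `|t| ^+ N.
Proof.
elim: N phi => [|N IH] phi d b t tr.
  by rewrite big_ord0 subr0 expr0 mulr1; exact: b.
have {}IH := IH (fun k => phi k.+1) (fun k => d k.+1) b.
have [s st|c ct e] := @MVT_sym _ (fun t => phi 0%N t - \sum_(k < N.+1) phi k 0 * t ^+ k / k`!%:R)
   (fun t => phi 1%N t - \sum_(k < N) phi k.+1 0 * t ^+ k / k`!%:R) t.
  have d1 := d 0%N s (le_trans st tr).
  have d2 := is_derive_poly_fact (fun k => phi k 0) N s.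
  exact: is_deriveB.
have z : phi 0%N 0 - \sum_(k < N.+1) phi k 0 * 0 ^+ k / k`!%:R = 0.
  rewrite big_ord_recl/= expr0 fact0 invr1 !mulr1 big1 ?addr0 ?subrr// => i _.
  by rewrite expr0n/= mulr0 mul0r.
move: e; rewrite z subr0 => ->.
rewrite normrM exprSr mulrA ler_wpM2r//.
have M0 : 0 <= M by apply: le_trans (b c (le_trans ct tr)).
apply: le_trans (IH c (le_trans ct tr)) _.
by rewrite ler_wpM2l// lerXn2r ?nnegrE.
Qed.

End Taylor.

(** * Expansions in powers of t *)

Section LittleO.
Variable R : realType.
Implicit Types (w x y b : R -> R).

(* The value at 0 is ignored, unlike in littleo_t; for elements of R_o[t] it is recovered
   by continuity from the right. *)
Definition lo w : Prop := (fun t => w t / t) @ 0^'+ --> (0 : R).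

Lemma cvg_near_eq (T : topologicalType) (f g : R -> T) (l : T) :
  (\forall t \near 0^'+, f t = g t) -> g @ 0^'+ --> l -> f @ 0^'+ --> l.
Proof.
move=> e gl; apply: cvg_trans gl; apply: near_eq_cvg.
by apply: filterS e => t ->.
Qed.

Lemma near0r_gt0 : \forall t \near (0 : R)^'+, 0 < t.
Proof. exact: nbhs_right_gt. Qed.

Lemma loP w : lo w <-> forall e, 0 < e -> \forall t \near 0^'+, `|w t| <= e * t.
Proof.
split=> [/cvgr0_norm_le h e e0|h].
  near=> t; have t0 : 0 < t by near: t; exact: near0r_gt0.
  rewrite -ler_pdivrMr// (_ : `|w t| / t = `|w t / t|); first by near: t; exact: h.
  by rewrite normf_div (gtr0_norm t0).
apply/cvgr0Pnorm_le => e e0; near=> t.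
have t0 : 0 < t by near: t; exact: near0r_gt0.
by rewrite normf_div (gtr0_norm t0) ler_pdivrMr//; near: t; exact: h.
Unshelve. all: by end_near. Qed.

Lemma lo_le (C : R) w x : (\forall t \near 0^'+, `|w t| <= C * `|x t|) -> lo x -> lo w.
Proof.
move=> wx /loP hx; apply/loP => e e0.
have C0 : 0 < `|C| + 1 by rewrite ltr_wpDl.
have := hx (e / (`|C| + 1)) (divr_gt0 e0 C0).
apply: filterS2 wx => t wx hxt; apply: (le_trans wx).
apply: (@le_trans _ _ ((`|C| + 1) * `|x t|)).
  by rewrite ler_wpM2r// (le_trans (ler_norm C))// lerDl.
by rewrite mulrC -ler_pdivlMr// mulrAC.
Qed.

Lemma lo_eq w x : (\forall t \near 0^'+, w t = x t) -> lo x -> lo w.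
Proof.
by move=> wx; apply: (@lo_le 1); apply: filterS wx => t ->; rewrite mul1r.
Qed.

Lemma lo0 : lo (fun=> 0).
Proof. by apply: cvg_near_cst; near=> t; rewrite mul0r. Unshelve. all: by end_near. Qed.

Lemma loD w x : lo w -> lo x -> lo (fun t => w t + x t).
Proof.
move=> hw hx; rewrite /lo -[0 in X in _ --> X]addr0.
by under eq_fun do rewrite mulrDl; exact: cvgD.
Qed.

Lemma loN w : lo w -> lo (fun t => - w t).
Proof.
by apply: (@lo_le 1); apply: nearW => t; rewrite normrN mul1r.
Qed.

Lemma loB w x : lo w -> lo x -> lo (fun t => w t - x t).
Proof. by move=> hw /loN; exact: loD. Qed.

Lemma loC w x : lo (fun t => w t - x t) -> lo (fun t => x t - w t).
Proof. by apply: (@lo_le 1); apply: nearW => t; rewrite distrC mul1r. Qed.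

Lemma lo_trans x w y : lo (fun t => w t - x t) -> lo (fun t => x t - y t) ->
  lo (fun t => w t - y t).
Proof.
move=> h1 h2; have := loD h1 h2; apply: lo_eq; apply: nearW => t; ring.
Qed.

Lemma loMb (M : R) b w : (\forall t \near 0^'+, `|b t| <= M) -> lo w ->
  lo (fun t => b t * w t).
Proof.
move=> hb; apply: (@lo_le M); apply: filterS hb => t bM.
by rewrite normrM ler_wpM2r.
Qed.

Lemma cvg_bnd b (l : R) : b @ 0^'+ --> l ->
  \forall t \near 0^'+, `|b t| <= `|l| + 1.
Proof.
move=> /cvgr_dist_le /(_ 1 ltr01); apply: filterS => t h.
rewrite -[b t](subrK l) (le_trans (ler_normD _ _))// addrC lerD2l.
by rewrite distrC.
Qed.

Lemma loMc b w (l : R) : b @ 0^'+ --> l -> lo w -> lo (fun t => b t * w t).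
Proof. by move=> /cvg_bnd; exact: loMb. Qed.

Lemma cvg_id0 : (fun t : R => t) @ 0^'+ --> (0 : R).
Proof. exact: cvg_within. Qed.

Lemma lo_cvg w : lo w -> w @ 0^'+ --> (0 : R).
Proof.
move=> h; have hh : (fun t => w t / t * t) @ 0^'+ --> (0 : R) * 0 by exact: (cvgM h cvg_id0).
rewrite mul0r in hh.
refine (cvg_near_eq _ hh); near=> t.
by rewrite /= divfK// gt_eqF//; near: t; exact: near0r_gt0.
Unshelve. all: by end_near. Qed.

Lemma lo_cvg_eq x y (a b : R) : lo (fun t => x t - y t) ->
  x @ 0^'+ --> a -> y @ 0^'+ --> b -> a = b.
Proof.
move=> /lo_cvg h xa yb.
have h2 : (fun t => x t - y t) @ 0^'+ --> a - b by exact: (cvgB xa yb).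
 apply/eqP; rewrite -subr_eq0; apply/eqP.
by apply: (cvg_unique _ h2 h); exact: Rhausdorff.
Qed.

Lemma pow_cvg0 (a : R) : 0 < a -> (fun t : R => t `^ a) @ 0^'+ --> (0 : R).
Proof. exact: powR_cvg0. Qed.

Lemma pow_cvg (a : R) : 0 <= a -> exists l : R, (fun t : R => t `^ a) @ 0^'+ --> l.
Proof.
rewrite le_eqVlt => /orP[/eqP<-|/pow_cvg0]; last by exists 0.
by exists 1; apply: cvg_near_cst; apply: nearW => t; rewrite powRr0.
Qed.

Lemma lo_pow (a : R) : 1 < a -> lo (fun t => t `^ a).
Proof.
move=> a1; have : 0 < a - 1 by rewrite subr_gt0.
move/pow_cvg0 => hh; apply: (cvg_near_eq _ hh); near=> t.
have t0 : 0 < t by near: t; exact: near0r_gt0.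
rewrite powRB ?powRr1 ?ltW//.
by apply/implyP => _; rewrite gt_eqF.
Unshelve. all: by end_near. Qed.

Lemma powD (t a b : R) : 0 < t -> t `^ (a + b) = t `^ a * t `^ b.
Proof. by move=> t0; rewrite powRD// (gt_eqF t0) implybT. Qed.

Definition infinitesimal_term (tau : R -> R) : Prop :=
  (exists c a, 0 < a /\ tau = fun t => c * t `^ a) \/ (lo tau /\ tau 0 = 0).

Lemma infinitesimal_term_cvg tau : infinitesimal_term tau -> tau @ 0^'+ --> (0 : R).
Proof.
case=> [[c [a [a0 ->]]]|[/lo_cvg//]].
by rewrite -[0 in X in _ --> X](mulr0 c); apply: cvgM; [exact: cvg_cst|exact: pow_cvg0].
Qed.

End LittleO.

(** * Taylor expansion along infinitesimal displacements *)

Section Expansion.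
Variables (R : realType) (E : normedModType R).
Implicit Types (W : set E) (A : E -> R).

(** A displacement decomposed into scalar infinitesimals along fixed directions, so that Taylor's
    formula can be applied to one direction at a time. *)
Definition steps (l : seq (E * (R -> R))) (t : R) : E := \sum_(s <- l) s.2 t *: s.1.

Definition good_steps (l : seq (E * (R -> R))) :=
  forall s, s \in l -> infinitesimal_term s.2.

Lemma steps_cvg l : good_steps l -> steps l @ 0^'+ --> (0 : E).
Proof.
elim: l => [|s l IH] gl.
  by apply: cvg_near_cst; apply: nearW => t; rewrite /steps big_nil.
have h1 : (fun t => s.2 t *: s.1) @ 0^'+ --> (0 : R) *: s.1.
  apply: cvgZr_tmp; apply: infinitesimal_term_cvg; apply: gl.
  by rewrite mem_head.
have h2 : steps l @ 0^'+ --> (0 : E).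
  by apply: IH => s' s'l; apply: gl; rewrite inE s'l orbT.
have h3 : (fun t => s.2 t *: s.1 + steps l t) @ 0^'+ --> (0 : R) *: s.1 + 0.
  exact: (cvgD h1 h2).
rewrite scale0r addr0 in h3; apply: (cvg_near_eq _ h3).
by apply: nearW => t; rewrite /steps big_cons.
Qed.

Definition dirder (v : E) (k : nat) A : E -> R := iter k (fun g x => 'D_v g x) A.

Lemma Cinf_dirder W v k A : Cinf W A -> Cinf W (dirder v k A).
Proof. by move=> CA; elim: k => //= k IH; exact: (Cinf_derive v IH). Qed.

Lemma derive_eq_on W (A B : E -> R) v x : open W -> W x ->
  (forall x, W x -> A x = B x) -> 'D_v A x = 'D_v B x.
Proof.
move=> oW Wx AB; apply: near_eq_derive; near=> y; apply: AB.
by near: y; exact: open_nbhs_nbhs.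
Unshelve. all: by end_near. Qed.

(** By repeated use of the symmetry of second derivatives. It identifies the Taylor coefficients of
    ['D_y A] with the [y]-derivatives of those of [A], so that an expansion may be differentiated
    term by term. *)
Lemma dirder_commute W (y v : E) k A x : open W -> Cinf W A -> W x ->
  'D_y (dirder v k A) x = dirder v k (fun x => 'D_y A x) x.
Proof.
move=> oW CA; elim: k x => // k IH x Wx.
rewrite /dirder/= -!/(dirder v k _) (Schwarz y v oW (Cinf_dirder v k CA) Wx).
exact: (derive_eq_on v oW Wx IH).
Qed.

(** One constant [M] serves for all small [t] although the base point [z t] moves, because the
    [N]-th derivative is bounded on a ball around the limit [z0]; base point and step each use up
    half of its radius. *)
Lemma Taylor_path W A v N (z : R -> E) (z0 : E) (tau : R -> R) : open W -> Cinf W A -> W z0 ->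
  z @ 0^'+ --> z0 -> tau @ 0^'+ --> (0 : R) ->
  exists M, \forall t \near 0^'+,
    `|A (z t + tau t *: v) - \sum_(k < N) dirder v k A (z t) * tau t ^+ k / k`!%:R|
      <= M * `|tau t| ^+ N.
Proof.
move=> oW CA Wz0 zz0 tau0.
have cN := Cinf_cont (Cinf_dirder v N CA) Wz0.
exists (`|dirder v N A z0| + 1).
have : \forall y \near z0, W y /\ `|dirder v N A y| <= `|dirder v N A z0| + 1.
  near=> y; split; first by near: y; exact: open_nbhs_nbhs.
  near: y; move/cvgr_dist_le: cN => /(_ 1 ltr01); apply: filterS => y h.
  rewrite -[dirder v N A y](subrK (dirder v N A z0)) (le_trans (ler_normD _ _))//.
  by rewrite addrC lerD2l distrC.
case/nbhs_ballP => r /= r0 br.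
have {}br y : `|z0 - y| < r -> W y /\ `|dirder v N A y| <= `|dirder v N A z0| + 1.
  by move=> yx; apply: br; rewrite -ball_normE.
have r2 : 0 < r / 2 by rewrite divr_gt0.
near=> t.
have zt : `|z0 - z t| < r / 2 by near: t; move/cvgr_dist_lt: zz0; exact.
have taut : `|tau t| * `|v| < r / 2.
  rewrite -normrZ; near: t.
  have : (fun t => tau t *: v) @ 0^'+ --> (0 : R) *: v by exact: cvgZr_tmp.
  by rewrite scale0r => /cvgr0_norm_lt; exact.
have inb s : `|s| <= `|tau t| -> `|z0 - (z t + s *: v)| < r.
  move=> st; rewrite opprD addrA (le_lt_trans (ler_normB _ _))// (splitr r).
  rewrite ltr_leD// ltW// (le_lt_trans _ taut)// normrZ ler_wpM2r//.
have := @Taylor_bound R (fun k s => dirder v k A (z t + s *: v)) N `|tau t|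
   (`|dirder v N A z0| + 1) _ _ (tau t) (lexx _).
rewrite scale0r addr0; apply.
  move=> k s /inb/br[Ws _].
  exact: (is_derive_line (Cinf_derivable (Cinf_dirder v k CA) Ws)).
by move=> s /inb/br[].
Unshelve. all: by end_near. Qed.

Lemma path_in W (z : R -> E) (z0 : E) : open W -> W z0 -> z @ 0^'+ --> z0 ->
  \forall t \near 0^'+, W (z t).
Proof. by move=> oW Wz0; apply; exact: open_nbhs_nbhs. Qed.

(** Exponents may be repeated in the list, so that concatenation of lists is addition; [coef]
    collects equal exponents later. *)
Definition gsum (L : seq (R * (E -> R))) (z : E) (t : R) : R :=
  \sum_(p <- L) t `^ p.1 * p.2 z.

Definition smooth_coefs W (L : seq (R * (E -> R))) :=
  forall p, p \in L -> 0 <= p.1 /\ Cinf W p.2.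

Definition dcoefs (y : E) (L : seq (R * (E -> R))) : seq (R * (E -> R)) :=
  [seq (p.1, fun x => 'D_y p.2 x) | p <- L].

(* The same expansion L must serve for all base paths z. *)
Definition expands W (y : E) (psi dpsi : (R -> E) -> R -> R) : Prop :=
  exists2 L, smooth_coefs W L &
    forall (z : R -> E) (z0 : E), W z0 -> z @ 0^'+ --> z0 ->
      lo (fun t => psi z t - gsum L (z t) t) /\
      lo (fun t => dpsi z t - gsum (dcoefs y L) (z t) t).

Section Expands.
Variables (W : set E) (y : E).
Hypothesis oW : open W.

Lemma expands_congr psi dpsi phi dphi :
  (forall (z : R -> E) (z0 : E), W z0 -> z @ 0^'+ --> z0 ->
     lo (fun t => phi z t - psi z t) /\ lo (fun t => dphi z t - dpsi z t)) ->
  expands W y psi dpsi -> expands W y phi dphi.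
Proof.
move=> H [L sL hL]; exists L => // z z0 Wz zz.
have [h1 h2] := hL z z0 Wz zz; have [h3 h4] := H z z0 Wz zz.
by split; [exact: lo_trans h3 h1|exact: lo_trans h4 h2].
Qed.

Lemma expands0 : expands W y (fun _ _ => 0) (fun _ _ => 0).
Proof.
exists [::] => // z z0 _ _; rewrite /gsum/=.
by split; apply: lo_eq (@lo0 R); apply: nearW => t; rewrite big_nil subr0.
Qed.

Lemma expandsD psi dpsi phi dphi : expands W y psi dpsi -> expands W y phi dphi ->
  expands W y (fun z t => psi z t + phi z t) (fun z t => dpsi z t + dphi z t).
Proof.
move=> [L1 s1 h1] [L2 s2 h2]; exists (L1 ++ L2).
  by move=> p; rewrite mem_cat => /orP[/s1|/s2].
move=> z z0 Wz zz; have [a1 b1] := h1 z z0 Wz zz; have [a2 b2] := h2 z z0 Wz zz.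
rewrite /gsum /dcoefs map_cat; split.
  by apply: lo_eq (loD a1 a2); apply: nearW => t; rewrite big_cat/= /gsum; ring.
by apply: lo_eq (loD b1 b2); apply: nearW => t; rewrite big_cat/= /gsum; ring.
Qed.

Lemma expandsZ (c a : R) psi dpsi : 0 <= a -> expands W y psi dpsi ->
  expands W y (fun z t => c * t `^ a * psi z t) (fun z t => c * t `^ a * dpsi z t).
Proof.
move=> a0 [L s h]; exists [seq (a + p.1, fun x => c * p.2 x) | p <- L].
  move=> p /mapP[q /s[q0 Cq] ->] /=; split; first exact: addr_ge0.
  exact: (CinfM oW (Cinf_cst c oW) Cq).
move=> z z0 Wz zz; have [h1 h2] := h z z0 Wz zz.
have [l pl] := pow_cvg a0.
have cpl : (fun t => c * t `^ a) @ 0^'+ --> c * l by apply: cvgM pl; exact: cvg_cst.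
split.
  apply: lo_eq (loMc cpl h1); near=> t.
  have t0 : 0 < t by near: t; exact: near0r_gt0.
  rewrite mulrBr /gsum big_map mulr_sumr; congr (_ - _).
  by apply: eq_bigr => p _ /=; rewrite powD//; ring.
apply: lo_eq (loMc cpl h2); near=> t.
have t0 : 0 < t by near: t; exact: near0r_gt0.
have Wt : W (z t) by near: t; exact: path_in Wz zz.
rewrite mulrBr /gsum /dcoefs !big_map mulr_sumr; congr (_ - _).
rewrite big_seq [RHS]big_seq; apply: eq_bigr => p /s[_ Cp] /=; rewrite powD//.
rewrite (_ : (fun x => c * p.2 x) = c \*: p.2)// deriveZ; last exact: (Cinf_derivable Cp Wt).
by rewrite /GRing.scale/=; ring.
Unshelve. all: by end_near. Qed.

Lemma expands_sum n (psi dpsi : nat -> (R -> E) -> R -> R) :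
  (forall k, expands W y (psi k) (dpsi k)) ->
  expands W y (fun z t => \sum_(k < n) psi k z t) (fun z t => \sum_(k < n) dpsi k z t).
Proof.
move=> H; elim: n => [|n IH].
  apply: expands_congr expands0 => z z0 _ _.
  by split; apply: lo_eq (@lo0 R); apply: nearW => t; rewrite big_ord0 subr0.
apply: expands_congr (expandsD IH (H n)) => z z0 _ _.
by split; apply: lo_eq (@lo0 R); apply: nearW => t; rewrite big_ord_recr/= subrr.
Qed.

Lemma lo_Taylor A v N (z : R -> E) (z0 : E) (tau : R -> R) : Cinf W A -> W z0 ->
  z @ 0^'+ --> z0 -> tau @ 0^'+ --> (0 : R) -> lo (fun t => tau t ^+ N) ->
  lo (fun t => A (z t + tau t *: v)
    - \sum_(k < N) dirder v k A (z t) * tau t ^+ k / k`!%:R).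
Proof.
move=> CA Wz zz t0; have [M hM] := Taylor_path v N oW CA Wz zz t0.
by apply: (@lo_le _ M); apply: filterS hM => t; rewrite normrX.
Qed.

(** Induction on the steps, for all [A] at once: the first step is removed by Taylor's formula at
    the point reached by the remaining ones, and the Taylor coefficients [dirder v k A] are expanded
    there by the induction hypothesis. *)
Lemma expansion l A : good_steps l -> Cinf W A ->
  expands W y (fun z t => A (z t + steps l t)) (fun z t => 'D_y A (z t + steps l t)).
Proof.
elim: l A => [|[v tau] l IH] A gl CA.
  exists [:: (0, A)]; first by move=> p; rewrite inE => /eqP ->.
  move=> z z0 _ _; rewrite /gsum /dcoefs /=; split; apply: lo_eq (@lo0 R);
    by apply: nearW => t; rewrite big_seq1/= /steps big_nil addr0 powRr0 mul1r subrr.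
have gl' : good_steps l by move=> s sl; apply: gl; rewrite inE sl orbT.
have /= gt : infinitesimal_term tau by apply: (gl (v, tau)); rewrite mem_head.
have t0 := infinitesimal_term_cvg gt.
have pc (z : R -> E) (z0 : E) : z @ 0^'+ --> z0 -> (fun t => z t + steps l t) @ 0^'+ --> z0.
  by move=> zz; rewrite -[z0]addr0; apply: cvgD zz (steps_cvg gl').
have stE z t : z t + steps ((v, tau) :: l) t = (z t + steps l t) + tau t *: v.
  by rewrite /steps big_cons/= -addrA; congr (_ + _); rewrite addrC.
case: gt => [[c [a [a0 taue]]]|[lt _]]; last first.
  (* A step of size o(t) changes neither [A] nor ['D_y A] modulo o(t), by Taylor's formula of order
     1. *)
  apply: expands_congr (IH A gl' CA) => z z0 Wz /pc zz.
  have lt1 : lo (fun t => tau t ^+ 1) by [].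
  have h1 := lo_Taylor v CA Wz zz t0 lt1.
  have h2 := lo_Taylor v (Cinf_derive y CA) Wz zz t0 lt1.
  split; [apply: lo_eq h1|apply: lo_eq h2]; apply: nearW => t;
    by rewrite stE big_ord1 expr0 fact0 invr1 !mulr1.
(* The least [N] with [a * N > 1], so that the remainder, of order t^(a N), is o(t). *)
pose N := (Num.truncn a^-1).+1.
have aN : 1 < a * N%:R by rewrite mulrC -ltr_pdivrMr// div1r; exact: truncnS_gt.
have tk k t : tau t ^+ k = c ^+ k * t `^ (a * k%:R).
  by rewrite taue exprMn powRrM powR_mulrn// powR_ge0.
have lN : lo (fun t => tau t ^+ N).
  apply: (@lo_le _ `|c ^+ N| _ (fun t => t `^ (a * N%:R))); last exact: lo_pow.
  by apply: nearW => t; rewrite tk normrM.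
have H k : expands W y
   (fun z t => c ^+ k / k`!%:R * t `^ (a * k%:R) * dirder v k A (z t + steps l t))
   (fun z t => c ^+ k / k`!%:R * t `^ (a * k%:R) * 'D_y (dirder v k A) (z t + steps l t)).
  apply: expandsZ; first by apply: mulr_ge0 => //; exact: ltW.
  by apply: IH => //; exact: Cinf_dirder.
apply: expands_congr (@expands_sum N _ _ H) => z z0 Wz /pc zz.
have h1 := lo_Taylor v CA Wz zz t0 lN.
have h2 := lo_Taylor v (Cinf_derive y CA) Wz zz t0 lN.
split; [apply: lo_eq h1|apply: lo_eq h2]; near=> t; rewrite stE; congr (_ - _);
  apply: eq_bigr => k _; rewrite tk.
  by ring.
(* Taylor's formula was applied to ['D_y A], whereas the induction gave the [y]-derivatives of the
   coefficients of [A]; the two agree at points of [W]. *)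
rewrite -(dirder_commute _ _ _ oW CA); first by ring.
by near: t; exact: path_in Wz zz.
Unshelve. all: by end_near. Qed.

End Expands.
End Expansion.

(** * Inequalities modulo o(t) *)

Section LeLo.
Variable R : realType.
Implicit Types (w x y : R -> R).

Definition le_lo x y : Prop :=
  exists2 z, lo z & \forall t \near 0^'+, x t <= y t + z t.

Lemma le_lo_congr x y x' y' : lo (fun t => x t - x' t) -> lo (fun t => y t - y' t) ->
  le_lo x y -> le_lo x' y'.
Proof.
move=> hx hy [z hz H]; exists (fun t => z t + ((y t - y' t) - (x t - x' t))).
  by apply: loD hz _; exact: loB.
by apply: filterS H => t; lra.
Qed.

Lemma le_lo_trans x y w : le_lo x y -> le_lo y w -> le_lo x w.
Proof.
move=> [z1 h1 H1] [z2 h2 H2]; exists (fun t => z1 t + z2 t); first exact: loD.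
by apply: filterS2 H1 H2 => t; lra.
Qed.

Lemma lo_le_lo x y : lo (fun t => x t - y t) -> le_lo x y.
Proof.
by move=> h; exists (fun t => x t - y t) => //; apply: nearW => t; rewrite addrC subrK.
Qed.

Lemma le_lo_refl x : le_lo x x.
Proof.
by apply: lo_le_lo; apply: lo_eq (@lo0 R); apply: nearW => t; rewrite subrr.
Qed.

Lemma le_lo_anti x y : le_lo x y -> le_lo y x -> lo (fun t => x t - y t).
Proof.
move=> [z1 /loP h1 H1] [z2 /loP h2 H2]; apply/loP => e e0.
near=> t; rewrite ler_norml; apply/andP; split.
  have : y t <= x t + z2 t by near: t; exact: H2.
  have : `|z2 t| <= e * t by near: t; exact: h2.
  by rewrite ler_norml => /andP[]; lra.
have : x t <= y t + z1 t by near: t; exact: H1.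
have : `|z1 t| <= e * t by near: t; exact: h1.
by rewrite ler_norml => /andP[]; lra.
Unshelve. all: by end_near. Qed.

Lemma le_lo_sub x y : le_lo x y <-> le_lo (fun=> 0) (fun t => y t - x t).
Proof.
by split=> -[z h H]; exists z => //; apply: filterS H => t; lra.
Qed.

(** From (x + z)(y + w) >= 0 with o(t) errors z and w: the three terms containing an error are o(t)
    because x and y stay bounded. *)
Lemma le_lo_mul x y (a b : R) : x @ 0^'+ --> a -> y @ 0^'+ --> b ->
  le_lo (fun=> 0) x -> le_lo (fun=> 0) y -> le_lo (fun=> 0) (fun t => x t * y t).
Proof.
move=> xa yb [z hz H] [w hw K].
exists (fun t => x t * w t + y t * z t + z t * w t).
  apply: loD; first by apply: loD; [exact: loMc xa hw|exact: loMc yb hz].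
  exact: loMc (lo_cvg hz) hw.
apply: filterS2 H K => t /= h k; nra.
Qed.

End LeLo.

Lemma seq_min (R : realType) (s : seq R) : s != [::] ->
  exists2 x, x \in s & forall y, y \in s -> x <= y.
Proof.
elim: s => // a s IH _; have [->|/IH[x xs xm]] := eqVneq s [::].
  by exists a; rewrite ?mem_head// => y; rewrite inE => /eqP ->.
have [ax|xa] := leP a x.
  exists a; rewrite ?mem_head// => y; rewrite inE => /orP[/eqP->//|/xm].
  exact: le_trans.
exists x; first by rewrite inE xs orbT.
by move=> y; rewrite inE => /orP[/eqP->|/xm//]; exact: ltW.
Qed.

(** * Collected coefficients and the lexicographic sign criterion *)

Section Coefficients.
Variables (R : realType) (E : normedModType R).
Implicit Types (L : seq (R * (E -> R))) (z : E) (e : R).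

Definition coef L e z : R := \sum_(p <- L | p.1 == e) p.2 z.

Definition nonneg_exps L := forall p, p \in L -> 0 <= p.1.

Definition exps L : seq R := undup [seq p.1 | p <- L].

Lemma coef_out L e z : e \notin exps L -> coef L e z = 0.
Proof.
move=> eL; rewrite /coef big_seq_cond big1// => p /andP[pL /eqP pe].
by move: eL; rewrite mem_undup -pe map_f.
Qed.

Lemma gsum_regroup L z t : gsum L z t = \sum_(x <- exps L) t `^ x * coef L x z.
Proof.
under eq_bigr do rewrite /coef mulr_sumr.
rewrite (exchange_big_dep xpredT)//= /gsum big_seq [RHS]big_seq.
apply: eq_bigr => p pL; rewrite (big_rem p.1)/=; last by rewrite mem_undup map_f.
rewrite eqxx big_seq_cond big1 ?addr0// => x /andP[].
by rewrite rem_filter ?undup_uniq// mem_filter/= eq_sym => /andP[/negbTE->].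
Qed.

Lemma cvg_seq_sum (s : seq R) (f : R -> R -> R) (l : R -> R) :
  (forall x, x \in s -> f x @ 0^'+ --> l x) ->
  (fun t => \sum_(x <- s) f x t) @ 0^'+ --> \sum_(x <- s) l x.
Proof.
elim: s => [|a s IH] h.
  by apply: cvg_near_cst; apply: nearW => t; rewrite !big_nil.
rewrite big_cons.
have h1 : f a @ 0^'+ --> l a by apply: h; rewrite mem_head.
have h2 : (fun t => \sum_(x <- s) f x t) @ 0^'+ --> \sum_(x <- s) l x.
  by apply: IH => x xs; apply: h; rewrite inE xs orbT.
have h3 : (fun t => f a t + \sum_(x <- s) f x t) @ 0^'+ --> l a + \sum_(x <- s) l x.
  exact: (cvgD h1 h2).
by apply: (cvg_near_eq _ h3); apply: nearW => t; rewrite big_cons.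
Qed.

Lemma gsum_leading L e z : (forall x, x < e -> coef L x z = 0) ->
  (fun t => gsum L z t / t `^ e) @ 0^'+ --> coef L e z.
Proof.
move=> low.
have -> : coef L e z = \sum_(x <- exps L) (if x == e then coef L e z else 0).
  have [eL|eL] := boolP (e \in exps L).
    rewrite (big_rem e)//= eqxx big_seq_cond big1 ?addr0// => x /andP[].
    by rewrite rem_filter ?undup_uniq// mem_filter/= => /andP[/negbTE->].
  rewrite coef_out// big_seq big1// => x xL.
  by case: eqP => // xe; rewrite -xe xL in eL.
suff h : (fun t => \sum_(x <- exps L) (t `^ x * coef L x z / t `^ e)) @ 0^'+ -->
   \sum_(x <- exps L) (if x == e then coef L e z else 0).
  by apply: (cvg_near_eq _ h); apply: nearW => t; rewrite gsum_regroup mulr_suml.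
apply: (@cvg_seq_sum _ (fun x t => t `^ x * coef L x z / t `^ e)) => x xL.
case: (ltgtP x e) => xe.
- by apply: cvg_near_cst; apply: nearW => t; rewrite low// mulr0 mul0r.
- have h : (fun t => t `^ (x - e) * coef L x z) @ 0^'+ --> (0 : R) * coef L x z.
    apply: cvgM; last exact: cvg_cst.
    by apply: pow_cvg0; rewrite subr_gt0.
  rewrite mul0r in h; apply: (cvg_near_eq _ h); near=> t.
  have t0 : 0 < t by near: t; exact: near0r_gt0.
  by rewrite powRB ?(gt_eqF t0) ?implybT// mulrAC.
- apply: cvg_near_cst; near=> t.
  have t0 : 0 < t by near: t; exact: near0r_gt0.
  by rewrite xe mulrAC divff ?mul1r// gt_eqF// powR_gt0.
Unshelve. all: by end_near. Qed.

(** Only the finitely many exponents up to 1 with nonzero coefficient matter, the others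
    contributing 0 or o(t). If there are any, the smallest one dominates by [gsum_leading]. *)
Lemma gsum_dichotomy L z :
  ((forall e, e <= 1 -> coef L e z = 0) /\ lo (gsum L z)) \/
  (exists e, [/\ e <= 1, forall x, x < e -> coef L x z = 0 & coef L e z != 0]).
Proof.
pose s := [seq x <- exps L | (x <= 1) && (coef L x z != 0)].
have [s0|/seq_min[e]] := eqVneq s [::].
  left; have c0 e : e <= 1 -> coef L e z = 0.
    move=> e1; have [eL|/coef_out//] := boolP (e \in exps L).
    apply/eqP/negP => /negP ce; have : e \in s by rewrite mem_filter e1 ce.
    by rewrite s0.
  split=> //.
  have h : (fun t => \sum_(x <- exps L) (t `^ x * coef L x z / t)) @ 0^'+ -->
      \sum_(x <- exps L) (0 : R).
    apply: (@cvg_seq_sum _ (fun x t => t `^ x * coef L x z / t)) => x xL.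
    have [x1|x1] := leP x 1.
      by apply: cvg_near_cst; apply: nearW => t; rewrite c0// mulr0 mul0r.
    have h : (fun t => t `^ x / t * coef L x z) @ 0^'+ --> (0 : R) * coef L x z.
      by apply: cvgM; [exact: lo_pow|exact: cvg_cst].
    by rewrite mul0r in h; apply: (cvg_near_eq _ h); apply: nearW => t; rewrite mulrAC.
  rewrite big1// in h; apply: (cvg_near_eq _ h); apply: nearW => t.
  by rewrite gsum_regroup mulr_suml.
rewrite mem_filter => /andP[/andP[e1 ce] eL] em; right; exists e; split=> // x xe.
have [xL|/coef_out//] := boolP (x \in exps L).
apply/eqP/negP => /negP cx.
have /em : x \in s by rewrite mem_filter cx xL (le_trans (ltW xe)).
by rewrite leNgt xe.
Qed.

Lemma lo_pow_div w e : e <= 1 -> lo w -> (fun t => w t / t `^ e) @ 0^'+ --> (0 : R).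
Proof.
move=> e1 h; have [l hl] : exists l : R, (fun t : R => t `^ (1 - e)) @ 0^'+ --> l.
  by apply: pow_cvg; rewrite subr_ge0.
have h2 : (fun t => w t / t * t `^ (1 - e)) @ 0^'+ --> 0 * l by exact: (cvgM h hl).
rewrite mul0r in h2; apply: (cvg_near_eq _ h2); near=> t.
have t0 : 0 < t by near: t; exact: near0r_gt0.
rewrite powRB ?(gt_eqF t0) ?implybT// powRr1 ?ltW//.
by rewrite mulrA divfK// gt_eqF.
Unshelve. all: by end_near. Qed.

(** A lowest nonzero coefficient would be the limit of the sum divided by t^e, while o(t) divided by
    t^e tends to 0 for e <= 1. This is the uniqueness of coefficients modulo o(t). *)
Lemma lo_gsum L z : lo (gsum L z) -> forall e, e <= 1 -> coef L e z = 0.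
Proof.
move=> h; have [[]//|[e [e1 /gsum_leading hl /negP[]]]] := gsum_dichotomy L z.
by apply/eqP; apply: (cvg_unique _ hl (lo_pow_div e1 h)); exact: Rhausdorff.
Qed.

(** Division by t^e with e <= 1 removes the o(t) error and leaves the coefficient as the limit. With
    its converse [lex_gsum_ge0] it turns nonnegativity modulo o(t) into a condition on real
    numbers. *)
Lemma gsum_ge0_lex L z e : e <= 1 -> le_lo (fun=> 0) (gsum L z) ->
  (forall x, x < e -> coef L x z = 0) -> 0 <= coef L e z.
Proof.
move=> e1 [w hw H] /gsum_leading hl.
have h : (fun t => gsum L z t / t `^ e + w t / t `^ e) @ 0^'+ --> coef L e z + 0.
  exact: (cvgD hl (lo_pow_div e1 hw)).
rewrite addr0 in h; apply: (cvgr_to_ge h); near=> t.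
rewrite -mulrDl divr_ge0 ?powR_ge0//; near: t; exact: H.
Unshelve. all: by end_near. Qed.

Lemma gsum_pos L z e : (forall x, x < e -> coef L x z = 0) -> 0 < coef L e z ->
  le_lo (fun=> 0) (gsum L z).
Proof.
move=> /gsum_leading hl c0; exists (fun=> 0); first exact: lo0.
have : \forall t \near 0^'+, 0 < gsum L z t / t `^ e 
    by move/cvgr_gt: hl => /(_ _ c0).
apply: filterS2 (near0r_gt0 R) => t t0; rewrite pmulr_lgt0 ?invr_gt0 ?powR_gt0//.
by rewrite addr0 => /ltW.
Qed.

Lemma lex_gsum_ge0 L z :
  (forall e, e <= 1 -> (forall x, x < e -> coef L x z = 0) -> 0 <= coef L e z) ->
  le_lo (fun=> 0) (gsum L z).
Proof.
move=> lex; have [[_ h]|[e [e1 low ce]]] := gsum_dichotomy L z.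
  apply: lo_le_lo; apply: lo_eq (loN h); apply: nearW => t; exact: sub0r.
by apply: (gsum_pos low); rewrite lt_def ce lex.
Qed.

Definition neg_coefs L : seq (R * (E -> R)) := [seq (p.1, fun x => - p.2 x) | p <- L].

Lemma gsum_cat L1 L2 z t : gsum (L1 ++ L2) z t = gsum L1 z t + gsum L2 z t.
Proof. by rewrite /gsum big_cat. Qed.

Lemma gsum_neg L z t : gsum (neg_coefs L) z t = - gsum L z t.
Proof.
rewrite /gsum big_map -sumrN; apply: eq_bigr => p _ /=; by rewrite mulrN.
Qed.

Lemma coef_cat L1 L2 e z : coef (L1 ++ L2) e z = coef L1 e z + coef L2 e z.
Proof. by rewrite /coef big_cat. Qed.

Lemma coef_neg L e z : coef (neg_coefs L) e z = - coef L e z.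
Proof. by rewrite /coef big_map -sumrN. Qed.

Lemma gsum_total L z : le_lo (fun=> 0) (gsum L z) \/ le_lo (gsum L z) (fun=> 0).
Proof.
have [[_ h]|[e [e1 low]]] := gsum_dichotomy L z.
  by right; apply: lo_le_lo; apply: lo_eq h; apply: nearW => t; rewrite subr0.
rewrite neq_lt => /orP[c0|c0]; last by left; exact: (gsum_pos low).
right; have := @gsum_pos (neg_coefs L) z e.
case; first by move=> x /low; rewrite coef_neg => ->; rewrite oppr0.
  by rewrite coef_neg oppr_gt0.
move=> w hw H; exists w => //; apply: filterS H => t; rewrite gsum_neg; lra.
Qed.

Lemma coef_derive L e y z : (forall p, p \in L -> derivable p.2 z y) ->
  is_derive z y (coef L e) (coef (dcoefs y L) e z).
Proof.
elim: L => [|p L IH] d.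
  rewrite /coef /dcoefs/= big_nil (_ : (fun _ => _) = cst 0); first exact: is_derive_cst.
  by apply/funext => x; rewrite big_nil.
have {}IH : is_derive z y (coef L e) (coef (dcoefs y L) e z).
  by apply: IH => q qL; apply: d; rewrite inE qL orbT.
have dp : is_derive z y p.2 ('D_y p.2 z) by apply/derivableP/d; rewrite mem_head.
rewrite /coef /dcoefs/= big_cons/=.
rewrite (_ : (fun _ => _) = fun x => (if p.1 == e then p.2 x else 0) + coef L e x); last first.
  by apply/funext => x; rewrite big_cons /coef; case: ifP => // _; rewrite add0r.
case: eqP => _; first exact: is_deriveD.
by under eq_fun do rewrite add0r.
Qed.

End Coefficients.

(** * Monotone families of expansions *)

Section RealFamilies.
Variable R : realType.
Implicit Types (h : R -> R) (L : seq (R * (R -> R))).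

(** The set where [T] holds has a supremum; a point of the set just below it passes [T] on to points
    beyond it, unless the supremum is [b]. The local hypothesis moves [T] only to the right. *)
Lemma interval_induction (T : R -> Prop) (a b : R) : a <= b ->
  (forall s, a <= s <= b -> exists2 d, 0 < d & forall u v, a <= u -> u <= v -> v <= b ->
     `|u - s| < d -> `|v - s| < d -> T u -> T v) ->
  T a -> T b.
Proof.
move=> ab loc Ta.
pose S := [set s | a <= s <= b /\ T s].
have Sa : S a by split=> //; rewrite lexx.
have ubS : ubound S b by move=> s [/andP[]].
have hS : has_sup S by split; [exists a|exists b].
have sS := ub_le_sup hS.2.
have as' : a <= sup S by exact: sS.
have sb : sup S <= b by apply: ge_sup => //; exists a.
have [|d d0 H] := loc (sup S); first by rewrite as'.
have [u [/andP[au ub] Tu] su] := sup_adherent d0 hS.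
have us : u <= sup S by apply: sS; split=> //; rewrite au.
have uS : `|u - sup S| < d by rewrite ltr_norml; apply/andP; split; lra.
have [bS|bS] := leP b (sup S).
  apply: (H u b) => //; rewrite (_ : b = sup S) ?subrr ?normr0//.
  by apply/eqP; rewrite eq_le bS sb.
pose v := Num.min b (sup S + d / 2).
have [vb vS] : v <= b /\ v <= sup S + d / 2 by rewrite !ge_min !lexx orbT.
have vs : sup S < v by rewrite lt_min bS ltrDl divr_gt0.
have Tv : T v.
  apply: (H u v) => //; first exact: le_trans (ltW vs).
  by rewrite gtr0_norm ?subr_gt0//; lra.
have : v <= sup S by apply: sS; split=> //; rewrite vb (le_trans as' (ltW vs)).
by rewrite leNgt vs.
Qed.

Lemma derive_zero_on h (a b s D : R) : a < b -> a <= s <= b -> is_derive s (1 : R) h D ->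
  (\forall x \near s, a <= x <= b -> h x = 0) -> D = 0.
Proof.
move=> ab /andP[as' sb] [dh <-] hz.
have hs : h s = 0 by apply: (nbhs_singleton hz); rewrite as'.
have hq : (fun k => k^-1 *: ((h \o shift s) (k *: (1 : R)) - h s)) @ 0^' --> 'D_1 h s by exact: dh.
have hz0 : \forall k \near (0 : R), a <= k + s <= b -> h (k + s) = 0.
  have c : (fun k : R => k + s) @ (0 : R) --> (0 + s : R).
    by apply: cvgD; [exact: cvg_id|exact: cvg_cst].
  by rewrite add0r in c; exact: (c _ hz).
(* Vanishing is known only inside [a, b], so the derivative is computed from one side: from the
   right if [s < b], from the left if [s] is the endpoint [b]. *)
have [sb'|bs] := ltP s b.
  have hr : (fun k => k^-1 *: ((h \o shift s) (k *: (1 : R)) - h s)) @ 0^'+ --> 'D_1 h s.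
    exact: cvg_dnbhs_at_right.
  apply: (cvg_unique _ hr); first exact: Rhausdorff.
  apply: cvg_near_cst; near=> k.
  have k0 : 0 < k by near: k; exact: near0r_gt0.
  have kb : k < b - s by near: k; apply: nbhs_right_lt; rewrite subr_gt0.
  have kz : a <= k + s <= b -> h (k + s) = 0 by near: k; exact: cvg_within hz0.
  rewrite /= -[k *: 1]/(k * 1) mulr1 hs subr0 kz ?scaler0//.
  by apply/andP; split; lra.
have hl : (fun k => k^-1 *: ((h \o shift s) (k *: (1 : R)) - h s)) @ 0^'- --> 'D_1 h s.
  exact: cvg_dnbhs_at_left.
apply: (cvg_unique _ hl); first exact: Rhausdorff.
apply: cvg_near_cst; near=> k.
have k0 : k < 0 by near: k; exact: nbhs_left_lt.
have kb : a - s < k by near: k; apply: nbhs_left_gt; lra.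
have kz : a <= k + s <= b -> h (k + s) = 0 by near: k; exact: cvg_within hz0.
rewrite /= -[k *: 1]/(k * 1) mulr1 hs subr0 kz ?scaler0//.
by apply/andP; split; lra.
Unshelve. all: by end_near. Qed.

Lemma derive_ge0_le h dh (u v : R) :
  (forall s, u <= s <= v -> is_derive s (1 : R) h (dh s)) ->
  (forall s, u <= s <= v -> 0 <= dh s) ->
  forall x y, u <= x -> x <= y -> y <= v -> h x <= h y.
Proof.
move=> d d0 x y ux xy yv.
have inuv s : s \in `[x, y] -> u <= s <= v.
  by rewrite in_itv/= => /andP[xs sy]; rewrite (le_trans ux)//= (le_trans sy).
have cc : {within `[x, y], continuous h}.
  by apply: derivable_within_continuous => t /inuv/d[].
have dd : forall t : R, t \in `]x, y[ -> is_derive t 1 h (dh t).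
  by move=> t /subset_itv_oo_cc/inuv; exact: d.
have [c /inuv cuv e] := MVT_segment xy dd cc.
by rewrite -subr_ge0 e mulr_ge0 ?subr_ge0// d0.
Qed.

Definition derivable_coefs L (s : R) := forall p, p \in L -> derivable p.2 s (1 : R).

(* Coefficients of the powers up to 1 are determined by the family modulo o(t),
   hence so are their derivatives. *)
Lemma coef_derive_unique L1 L2 (a b s e : R) : a < b -> a <= s <= b -> e <= 1 ->
  derivable_coefs L1 s -> derivable_coefs L2 s ->
  (\forall x \near s, a <= x <= b -> lo (fun t => gsum L1 x t - gsum L2 x t)) ->
  coef (dcoefs (1 : R) L1) e s = coef (dcoefs (1 : R) L2) e s.
Proof.
move=> ab asb e1 d1 d2 H; apply/eqP; rewrite -subr_eq0; apply/eqP.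
apply: (@derive_zero_on (fun x => coef L1 e x - coef L2 e x) a b s) => //.
  by apply: is_deriveB; exact: coef_derive.
apply: filterS H => x H xab; rewrite -coef_neg -coef_cat; apply: lo_gsum => //.
by apply: lo_eq (H xab); apply: nearW => t; rewrite gsum_cat gsum_neg.
Qed.

(** By the lexicographic criterion, the increment at [e] matters only if all lower coefficients take
    equal values at [u] and [v]. Then these are in fact constant on [u, v], so [lex] applies at [e]
    for every [s] and the coefficient of t^e is nondecreasing. *)
Lemma lex_derive_mono L (u v : R) : u <= v ->
  (forall s, u <= s <= v -> derivable_coefs L s) ->
  (forall s, u <= s <= v -> forall e, e <= 1 ->
     (forall x, x < e -> coef (dcoefs (1 : R) L) x s = 0) ->
     0 <= coef (dcoefs (1 : R) L) e s) ->
  le_lo (gsum L u) (gsum L v).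
Proof.
rewrite le_eqVlt => /orP[/eqP-> _ _|uv dL lex]; first exact: le_lo_refl.
(* The increments as constant coefficient functions, so that the criterion can be used at the dummy
   point 0. *)
pose M : seq (R * (R -> R)) := [seq (p.1, fun=> p.2 v - p.2 u) | p <- L].
have cM e : coef M e 0 = coef L e v - coef L e u.
  by rewrite /coef big_map sumrB.
suff : le_lo (fun=> 0) (gsum M 0).
  move=> h; apply/le_lo_sub; move: h; apply: le_lo_congr.
    by apply: lo_eq (@lo0 R); apply: nearW => t; rewrite subrr.
  apply: lo_eq (@lo0 R); apply: nearW => t; rewrite /gsum big_map.
  by rewrite -!sumrB big1// => p _ /=; ring.
apply: lex_gsum_ge0 => e e1 low; rewrite cM subr_ge0.
have D e' s : u <= s <= v -> is_derive s (1 : R) (coef L e') (coef (dcoefs (1 : R) L) e' s).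
  by move=> /dL; exact: coef_derive.
(* At the lowest exponent [m] below [e] whose derivative is not identically 0 (it exists since the
   list is finite), [lex] makes that derivative nonnegative throughout. The coefficient is then
   monotone with equal end values, hence constant: a contradiction. *)
have below x : x < e -> forall s, u <= s <= v -> coef (dcoefs (1 : R) L) x s = 0.
  move=> xe s0 s0uv; apply/eqP/negP => /negP bad.
  pose B := [seq x <- exps (dcoefs (1 : R) L) | (x < e) &&
     `[< exists2 s, u <= s <= v & coef (dcoefs (1 : R) L) x s != 0 >]].
  have inB x' s' : x' < e -> u <= s' <= v -> coef (dcoefs (1 : R) L) x' s' != 0 -> x' \in B.
    move=> x'e suv c; rewrite mem_filter x'e/=; apply/andP; split.
      by apply/asboolP; exists s'.
    by apply: contraNT c => /coef_out ->.
  have /seq_min[m mB mmin] : B != [::].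
    by apply/eqP => B0; have := inB x s0 xe s0uv bad; rewrite B0.
  move: mB; rewrite mem_filter => /andP[/andP[me /asboolP[s suv /eqP cm]] _].
  apply: cm.
  have zero y s' : y < m -> u <= s' <= v -> coef (dcoefs (1 : R) L) y s' = 0.
    move=> ym s'uv; apply/eqP/negP => /negP c.
    have /mmin : y \in B by apply: inB c => //; exact: lt_trans me.
    by rewrite leNgt ym.
  have ge0 s' : u <= s' <= v -> 0 <= coef (dcoefs (1 : R) L) m s'.
    move=> s'uv; apply: lex => //; first exact: le_trans (ltW me) e1.
    by move=> y ym; exact: zero.
  have mono := derive_ge0_le (D m) ge0.
  have eq : coef L m v = coef L m u by apply/eqP; rewrite -subr_eq0 -cM low.
  apply: (@derive_zero_on (fun x => coef L m x - coef L m u) u v s _ uv suv).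
    by rewrite -[X in is_derive _ _ _ X]subr0; apply: is_deriveB; exact: D.
  apply/nbhs_ballP; exists 1 => //= y _ /andP[uy yv]; apply/eqP; rewrite subr_eq0 eq_le.
  by rewrite (mono u y)// -eq (mono y v).
apply: (derive_ge0_le (D e)) => //; last exact: ltW.
move=> s suv; apply: lex => // x xe; exact: below.
Qed.

(** Each [s] comes with its own expansion, valid near [s], but with a sign condition at [s] alone.
    Interval induction reduces the claim to one neighbourhood, where the sign at every other point
    has to be transferred to a single expansion. *)
Theorem family_mono (Phi : R -> R -> R) :
  (forall s : R, 0 <= s <= 1 -> exists L, [/\ \forall x \near s, derivable_coefs L x,
       \forall x \near s, 0 <= x <= 1 -> lo (fun t => Phi x t - gsum L x t) &
       le_lo (fun=> 0) (gsum (dcoefs (1 : R) L) s)]) ->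
  le_lo (Phi 0) (Phi 1).
Proof.
move=> H.
apply: (@interval_induction (fun s => le_lo (Phi 0) (Phi s)) 0 1 ler01); last exact: le_lo_refl.
move=> s s01; have [L [dL eL _]] := H s s01.
have /nbhs_ballP[d d0 hd] : \forall x \near s, derivable_coefs L x /\
    (0 <= x <= 1 -> lo (fun t => Phi x t - gsum L x t)).
  by apply: filterS2 dL eL => x; split.
have {}hd x : `|x - s| < d -> derivable_coefs L x /\
    (0 <= x <= 1 -> lo (fun t => Phi x t - gsum L x t)).
  by move=> xs; apply: hd; rewrite /ball/= distrC.
exists d => // u v u0 uv v1 us vs h; apply: (le_lo_trans h).
have inuv x : u <= x <= v -> `|x - s| < d.
  move=> /andP[ux xv]; move: us vs; rewrite !ltr_norml => /andP[? ?] /andP[? ?].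
  by apply/andP; split; lra.
have [_ hu] := hd u us; have [_ hv] := hd v vs.
have u01 : 0 <= u <= 1 by rewrite u0 (le_trans uv).
have v01 : 0 <= v <= 1 by rewrite v1 (le_trans u0).
apply: le_lo_congr (loC (hu u01)) (loC (hv v01)) _.
apply: lex_derive_mono => // [x /inuv/hd[]//|x xuv e e1 low].
have x01 : 0 <= x <= 1.
  by move: xuv => /andP[? ?]; apply/andP; split; lra.
have [dx _] := hd x (inuv x xuv).
have [L' [dL' eL' pL']] := H x x01.
(* The sign at [x] is known for [L'], the expansion attached to [x], but is needed for [L], attached
   to [s]. Both describe the same family near [x], so their differentiated coefficients agree up to
   exponent 1. *)
have same e' : e' <= 1 -> coef (dcoefs (1 : R) L) e' x = coef (dcoefs (1 : R) L') e' x.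
  move=> e'1; apply: (coef_derive_unique ltr01 x01 e'1 dx (nbhs_singleton dL')).
  have nx : \forall y \near x, `|y - x| < d - `|x - s|.
    have p : 0 < d - `|x - s| by rewrite subr_gt0; exact: inuv.
    apply/nbhs_ballP; exists (d - `|x - s|) => // y.
    by rewrite /ball/= distrC.
  apply: filterS2 nx eL' => y yx h' y01.
  have ys : `|y - s| < d.
    rewrite (_ : y - s = (y - x) + (x - s)); last by ring.
    by apply: (le_lt_trans (ler_normD _ _)); lra.
  have [_ hy] := hd y ys.
  exact: lo_trans (loC (hy y01)) (h' y01).
rewrite same//; apply: gsum_ge0_lex => // z ze; rewrite -same ?low//.
by apply: le_trans e1; exact: ltW.
Qed.

End RealFamilies.

(** * Fermat reals *)

Section Projections.
Variable R : realType.

Lemma Cinf_fst (U V : normedModType R) (W : set (U * V)) (f : U -> R) : open W ->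
  continuous f -> (forall a x y, f (a *: x + y) = a * f x + f y) ->
  Cinf W (fun z => f z.1).
Proof.
move=> oW cf lf; apply: Cinf_linear => //; last by move=> a x y /=; rewrite lf.
by move=> z; apply: continuous_comp; [exact: cvg_fst|exact: cf].
Qed.

Lemma Cinf_snd (U V : normedModType R) (W : set (U * V)) (f : V -> R) : open W ->
  continuous f -> (forall a x y, f (a *: x + y) = a * f x + f y) ->
  Cinf W (fun z => f z.2).
Proof.
move=> oW cf lf; apply: Cinf_linear => //; last by move=> a x y /=; rewrite lf.
by move=> z; apply: continuous_comp; [exact: cvg_snd|exact: cf].
Qed.

End Projections.

(** * Little-oh polynomials and their closure under smooth functions *)

Section RotTheory.
Variable R : realType.
Implicit Types (x y : R -> R).

Lemma pow_cvg_at0 (e : R) : 0 <= e -> (fun t : R => t `^ e) @ 0^'+ --> (0 : R) `^ e.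
Proof.
rewrite le_eqVlt => /orP[/eqP<-|e0].
  by rewrite powRr0; apply: cvg_near_cst; apply: nearW => t; rewrite powRr0.
by rewrite powR0 ?gt_eqF//; exact: pow_cvg0.
Qed.

Lemma gsum_cvg_at0 (E : normedModType R) (L : seq (R * (E -> R))) z : nonneg_exps L ->
  gsum L z @ 0^'+ --> gsum L z 0.
Proof.
elim: L => [|p L IH] h.
  by apply: cvg_near_cst; apply: nearW => t; rewrite /gsum !big_nil.
have h1 : (fun t => t `^ p.1 * p.2 z) @ 0^'+ --> (0 : R) `^ p.1 * p.2 z.
  by apply: cvgM; [apply: pow_cvg_at0; apply: h; rewrite mem_head|exact: cvg_cst].
have h2 : gsum L z @ 0^'+ --> gsum L z 0.
  by apply: IH => q qL; apply: h; rewrite inE qL orbT.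
have h3 : (fun t => t `^ p.1 * p.2 z + gsum L z t) @ 0^'+ -->
    (0 : R) `^ p.1 * p.2 z + gsum L z 0 by exact: (cvgD h1 h2).
rewrite {2}/gsum big_cons; apply: (cvg_near_eq _ h3).
by apply: nearW => t; rewrite /gsum big_cons.
Qed.

(** Right-continuity of [x] at 0 supplies the condition [w 0 = 0] of [littleo_t], which [lo] does
    not record. *)
Lemma Rot_gsum (E : normedModType R) (L : seq (R * (E -> R))) z x : nonneg_exps L ->
  x @ 0^'+ --> x 0 -> lo (fun t => x t - gsum L z t) -> Rot x.
Proof.
move=> nL x0 h; pose d : R * (E -> R) := (0, fun=> 0).
exists 0, (size L), (fun i => (nth d L i).2 z), (fun i => (nth d L i).1),
  (fun t => x t - gsum L z t); split.
  by move=> i; apply: nL; exact: mem_nth.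
split.
  split=> //; apply/eqP; rewrite subr_eq0; apply/eqP.
  exact: (lo_cvg_eq h x0 (gsum_cvg_at0 nL)).
move=> t _; rewrite add0r /gsum (big_nth d) big_mkord.
rewrite addrC -addrA [X in _ + X](_ : _ = 0) ?addr0//.
rewrite addrC; apply/eqP; rewrite subr_eq0; apply/eqP.
by apply: eq_bigr => i _; rewrite mulrC.
Qed.

Lemma Rot_steps x : Rot x -> exists2 s : seq (R -> R),
  forall tau, tau \in s -> infinitesimal_term tau &
  forall t, 0 <= t -> x t = x 0 + \sum_(tau <- s) tau t.
Proof.
case=> r [k [al [aa [w [aa0 [[w0 lw] xE]]]]]].
(* Terms of exponent 0 are constant even at [t = 0], where the power is 1; they are part of [x 0]
   and leave the zero function here. *)
pose tau (i : 'I_k) : R -> R := if aa i == 0 then fun=> 0 else fun t => al i * t `^ aa i.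
exists (w :: [seq tau i | i <- index_enum 'I_k]).
  move=> f; rewrite inE => /orP[/eqP->|/mapP[i _ ->]]; first by right.
  rewrite /tau; case: eqP => [_|/eqP ai]; first by right; split=> //; exact: lo0.
  by left; exists (al i), (aa i); split=> //; rewrite lt_def ai aa0.
move=> t t0; rewrite !xE// w0 addr0 big_cons big_map.
have -> : \sum_(i < k) al i * t `^ aa i = \sum_(i < k) al i * 0 `^ aa i + \sum_(i < k) tau i t.
  rewrite -big_split/=; apply: eq_bigr => i _; rewrite /tau.
  by case: eqP => [->|/eqP ai]; rewrite ?powRr0 ?addr0// powR0// mulr0 add0r.
by rewrite -!addrA; congr (_ + (_ + _)); rewrite addrC.
Qed.

Section Paths.
Variable E : normedModType R.

Definition fermat_path (x : R -> E) : Prop := exists2 l, good_steps l &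
  forall t, 0 <= t -> x t = x 0 + steps l t.

Lemma fermat_path_cvg (x : R -> E) : fermat_path x -> x @ 0^'+ --> x 0.
Proof.
case=> l gl xE; have h : (fun t => x 0 + steps l t) @ 0^'+ --> x 0 + (0 : E).
  by apply: cvgD (steps_cvg gl); exact: cvg_cst.
rewrite addr0 in h; apply: (cvg_near_eq _ h).
by apply: filterS (near0r_gt0 R) => t /ltW; exact: xE.
Qed.

Lemma fermat_pathZ (x : R -> R) (v : E) : Rot x -> fermat_path (fun t => x t *: v).
Proof.
move=> /Rot_steps[s gs xE]; exists [seq (v, tau) | tau <- s].
  by move=> p /mapP[tau /gs ? ->].
by move=> t /xE->; rewrite /steps big_map/= scalerDl scaler_suml.
Qed.

Lemma fermat_pathD (x y : R -> E) : fermat_path x -> fermat_path y ->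
  fermat_path (fun t => x t + y t).
Proof.
move=> [l1 g1 h1] [l2 g2 h2]; exists (l1 ++ l2).
  by move=> s; rewrite mem_cat => /orP[/g1|/g2].
by move=> t t0; rewrite h1// h2// /steps big_cat/= addrACA.
Qed.

Lemma fermat_path_cst (v : E) : fermat_path (fun=> v).
Proof. by exists [::] => // t _; rewrite /steps big_nil addr0. Qed.

Lemma fermat_path_sum (I : Type) (s : seq I) (x : I -> R -> E) :
  (forall i, fermat_path (x i)) -> fermat_path (fun t => \sum_(i <- s) x i t).
Proof.
move=> H; elim: s => [|i s IH].
  by under eq_fun do rewrite big_nil; exact: fermat_path_cst.
by under eq_fun do rewrite big_cons; exact: fermat_pathD.
Qed.

(** The expansion around the constant path [x 0] has constant coefficients, hence is a little-oh
    polynomial. Applied to addition and multiplication on [R * R], this also yields the ring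
    operations below. *)
Lemma Rot_smooth (W : set E) (A : E -> R) (x : R -> E) : open W -> Cinf W A -> fermat_path x ->
  W (x 0) -> Rot (fun t => A (x t)).
Proof.
move=> oW CA px Wx; have xc := fermat_path_cvg px; have [l gl xE] := px.
have [L sL hL] := expansion 0 oW gl CA.
have [h _] := hL (fun=> x 0) (x 0) Wx (cvg_cst _).
apply: (@Rot_gsum _ L (x 0)).
- by move=> p /sL[].
- by apply: (cvg_comp _ _ xc); exact: (Cinf_cont CA Wx).
- apply: lo_eq h; apply: filterS (near0r_gt0 R) => t /ltW t0.
  by rewrite xE.
Qed.

End Paths.

Lemma Rot_path x : Rot x -> fermat_path (x : R -> R).
Proof.
move=> rx; have [l gl xE] := fermat_pathZ (1 : R) rx; exists l => // t t0.
by have := xE t t0; rewrite -![_ *: 1]/(_ * _) !mulr1.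
Qed.

Lemma Rot_cvg x : Rot x -> x @ 0^'+ --> x 0.
Proof. by move=> /Rot_path/fermat_path_cvg. Qed.

Lemma Rot_cst (c : R) : Rot (fun=> c).
Proof.
apply: (@Rot_gsum R [:: (0, fun=> c)] 0) => //; [|exact: cvg_cst|].
  by move=> p; rewrite inE => /eqP->.
apply: lo_eq (@lo0 R); apply: nearW => t.
by rewrite /gsum big_seq1/= powRr0 mul1r subrr.
Qed.

Lemma Rot_pow (e : R) : 0 <= e -> Rot (fun t => t `^ e).
Proof.
move=> e0; apply: (@Rot_gsum R [:: (e, fun=> 1)] 0); [|exact: pow_cvg_at0|].
  by move=> p; rewrite inE => /eqP->.
apply: lo_eq (@lo0 R); apply: nearW => t.
by rewrite /gsum big_seq1/= mulr1 subrr.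
Qed.

Lemma Rot_pair x y : Rot x -> Rot y -> fermat_path (fun t => (x t, y t) : R * R).
Proof.
move=> rx ry.
have h := fermat_pathD (fermat_pathZ ((1, 0) : R * R) rx) (fermat_pathZ ((0, 1) : R * R) ry).
have e : (fun t => (x t, y t) : R * R) = fun t => x t *: ((1, 0) : R * R) + y t *: ((0, 1) : R * R).
  apply/funext => t; apply/pair_equal_spec; split=> /=;
  by rewrite -![_ *: _]/(_ * _) mulr1 mulr0 ?addr0 ?add0r.
by rewrite e.
Qed.

Lemma Cinf_fst1 (W : set (R * R)) : open W -> Cinf W (fun z => z.1).
Proof. by move=> oW; apply: (Cinf_fst (f := id)) => // x; exact: cvg_id. Qed.

Lemma Cinf_snd1 (W : set (R * R)) : open W -> Cinf W (fun z => z.2).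
Proof. by move=> oW; apply: (Cinf_snd (f := id)) => // x; exact: cvg_id. Qed.

Lemma RotD x y : Rot x -> Rot y -> Rot (fun t => x t + y t).
Proof.
move=> rx ry; have oT := @openT (R * R)%type.
exact: (Rot_smooth oT (CinfD oT (Cinf_fst1 oT) (Cinf_snd1 oT)) (Rot_pair rx ry)).
Qed.

Lemma RotM x y : Rot x -> Rot y -> Rot (fun t => x t * y t).
Proof.
move=> rx ry; have oT := @openT (R * R)%type.
exact: (Rot_smooth oT (CinfM oT (Cinf_fst1 oT) (Cinf_snd1 oT)) (Rot_pair rx ry)).
Qed.

Lemma RotN x : Rot x -> Rot (fun t => - x t).
Proof.
move=> rx; have := RotM (Rot_cst (-1)) rx.
by under eq_fun do rewrite mulN1r.
Qed.

Lemma RotB x y : Rot x -> Rot y -> Rot (fun t => x t - y t).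
Proof. by move=> rx /RotN; exact: RotD. Qed.

Lemma Rot_sum (I : Type) (s : seq I) (x : I -> R -> R) : (forall i, Rot (x i)) ->
  Rot (fun t => \sum_(i <- s) x i t).
Proof.
move=> H; elim: s => [|i s IH].
  by under eq_fun do rewrite big_nil; exact: Rot_cst.
by under eq_fun do rewrite big_cons; exact: RotD.
Qed.

Lemma Rot_gsum_comp (V : set R) (L : seq (R * (R -> R))) x : open V -> smooth_coefs V L ->
  Rot x -> V (x 0) -> Rot (fun t => gsum L (x t) t).
Proof.
move=> oV + rx Vx; rewrite /gsum; elim: L => [|p L IH] sL.
  by under eq_fun do rewrite big_nil; exact: Rot_cst.
under eq_fun do rewrite big_cons.
have [p0 Cp] := sL p (mem_head _ _).
apply: RotD; last by apply: IH => q qL; apply: sL; rewrite inE qL orbT.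
by apply: RotM; [exact: Rot_pow|exact: (Rot_smooth oV Cp (Rot_path rx))].
Qed.

End RotTheory.

Section FermatReals.
Variable R : realType.
Implicit Types (X Y Z : FR R) (x y : R -> R).

Lemma simtP x y : Rot x -> Rot y -> simt x y <-> lo (fun t => x t - y t).
Proof.
move=> rx ry; split=> [[]//|h]; split=> //.
by apply/eqP; rewrite subr_eq0 (lo_cvg_eq h (Rot_cvg rx) (Rot_cvg ry)).
Qed.

Lemma rep_spec X : Rot (rep X) /\ proj1_sig X = cls (rep X).
Proof. by rewrite /rep; case: (cid _). Qed.

Lemma Rot_rep X : Rot (rep X).
Proof. exact: (rep_spec X).1. Qed.

Lemma mkFR_val x : Rot x -> proj1_sig (mkFR x) = cls x.
Proof. by rewrite /mkFR; case: pselect. Qed.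

Lemma cls_eq x y : Rot x -> Rot y -> cls x = cls y <-> lo (fun t => x t - y t).
Proof.
move=> rx ry; split=> [e|h].
  have : cls y y by split=> //; apply/simtP => //; apply: lo_eq (@lo0 R); apply: nearW => t; rewrite subrr.
  by rewrite -e => -[_ /(simtP rx ry)].
apply/seteqP; split=> z [rz] /simtP => /(_ _ rz) k; split=> //; apply/simtP => //.
  exact: lo_trans (loC h) (k rx).
exact: lo_trans h (k ry).
Qed.

Lemma FR_eq X Y : X = Y <-> lo (fun t => rep X t - rep Y t).
Proof.
rewrite -cls_eq; [|exact: Rot_rep|exact: Rot_rep].
rewrite -(rep_spec X).2 -(rep_spec Y).2; split=> [->//|].
by case: X Y => [X hX] [Y hY] /= e; exact: eq_exist.
Qed.

Lemma rep_mkFR x : Rot x -> lo (fun t => rep (mkFR x) t - x t).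
Proof.
move=> rx; apply/cls_eq => //; first exact: Rot_rep.
by rewrite -(rep_spec _).2 mkFR_val.
Qed.

Lemma mkFR_eq x y : Rot x -> Rot y -> mkFR x = mkFR y <-> lo (fun t => x t - y t).
Proof.
move=> rx ry; rewrite FR_eq; have hx := rep_mkFR rx; have hy := rep_mkFR ry.
split=> h; first exact: lo_trans (loC hx) (lo_trans h hy).
exact: lo_trans hx (lo_trans h (loC hy)).
Qed.

Lemma mkFR_rep X : mkFR (rep X) = X.
Proof. by apply/FR_eq; apply: rep_mkFR; exact: Rot_rep. Qed.

Lemma std_mkFR x : Rot x -> std (mkFR x) = x 0.
Proof.
move=> rx; exact: (lo_cvg_eq (rep_mkFR rx) (Rot_cvg (Rot_rep _)) (Rot_cvg rx)).
Qed.

Lemma le_lo_cvg x y : Rot x -> Rot y -> le_lo x y -> x 0 <= y 0.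
Proof.
move=> rx ry [z hz H]; have zc := lo_cvg hz.
have h : (fun t => y t + z t - x t) @ 0^'+ --> y 0 + 0 - x 0.
  by apply: cvgB (Rot_cvg rx); apply: cvgD zc; exact: Rot_cvg.
rewrite addr0 in h; rewrite -subr_ge0; apply: (cvgr_to_ge h).
by apply: filterS H => t; rewrite subr_ge0.
Qed.

Lemma FRleP X Y : FRle X Y <-> le_lo (rep X) (rep Y).
Proof.
have rX := Rot_rep X; have rY := Rot_rep Y; split.
  case=> z [rz [[_ hz] [d [d0 H]]]]; exists z.
    by apply: lo_eq hz; apply: nearW => t; rewrite subr0.
  near=> t; apply: H; rewrite ltW/=; last by near: t; exact: near0r_gt0.
  by near: t; exact: nbhs_right_lt.
move=> XY; have XY0 := le_lo_cvg rX rY XY; have [z hz H] := XY.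
(* [FRle] asks for an error term in R_o[t] that vanishes at 0, and for the inequality at [t = 0] as
   well. Resetting [z] at 0 provides the former, and [XY0] the latter. *)
pose z' t := if t == 0 then 0 else z t.
have lz' : littleo_t z'.
  split; first by rewrite /z' eqxx.
  apply: lo_eq hz; apply: filterS (near0r_gt0 R) => t t0.
  by rewrite /z' gt_eqF.
have [d d0 hd] : exists2 d, 0 < d & forall t, 0 < t -> t < d -> rep X t <= rep Y t + z t.
  move: H => [d /= d0 hd]; exists d => // t t0 td; apply: hd => //.
  by rewrite /ball/= sub0r normrN gtr0_norm.
exists z'; split; last split.
- exists 0, 0%N, (fun _ => 0), (fun _ => 0), z'; split=> //; split=> // t _.
  by rewrite big_ord0 !add0r.
- by case: lz' => z0 lz; split; rewrite ?z0 ?subr0//; under eq_fun do rewrite subr0.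
- exists d; split=> // t /andP[t0 td]; rewrite /z'; case: eqP => [->|/eqP tn0].
    by rewrite addr0.
  by apply: hd => //; rewrite lt_def tn0.
Unshelve. all: by end_near. Qed.

Lemma FRle_mkFR x y : Rot x -> Rot y -> FRle (mkFR x) (mkFR y) <-> le_lo x y.
Proof.
move=> rx ry; rewrite FRleP; have hx := rep_mkFR rx; have hy := rep_mkFR ry.
by split; apply: le_lo_congr => //; exact: loC.
Qed.

Lemma FRle_refl X : FRle X X.
Proof. by apply/FRleP; exact: le_lo_refl. Qed.

Lemma FRle_trans Y X Z : FRle X Y -> FRle Y Z -> FRle X Z.
Proof. by move=> /FRleP h1 /FRleP h2; apply/FRleP; exact: le_lo_trans h1 h2. Qed.

Lemma FRle_anti X Y : FRle X Y -> FRle Y X -> X = Y.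
Proof. by move=> /FRleP h1 /FRleP h2; apply/FR_eq; exact: le_lo_anti. Qed.

Definition const_coefs (D : seq (R * R)) : seq (R * (R -> R)) :=
  [seq (p.1, fun=> p.2) | p <- D].

Lemma Rot_expansion x : Rot x -> exists2 D : seq (R * R), (forall p, p \in D -> 0 <= p.1) &
  lo (fun t => x t - gsum (const_coefs D) 0 t).
Proof.
case=> r [k [al [aa [w [aa0 [[w0 lw] xE]]]]]].
exists ((0, r) :: [seq (aa i, al i) | i <- index_enum 'I_k]).
  by move=> p; rewrite inE => /orP[/eqP->|/mapP[i _ ->]]; [exact: lexx|exact: aa0].
apply: lo_eq lw; apply: filterS (near0r_gt0 R) => t t0.
rewrite xE ?ltW// /gsum /const_coefs big_map big_cons big_map/= powRr0 mul1r.
rewrite [X in _ - (_ + X)](_ : _ = \sum_(i < k) al i * t `^ aa i); first by ring.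
by apply: eq_bigr => i _; rewrite mulrC.
Qed.

(** The difference of representatives is a finite sum of powers modulo o(t), and its lowest nonzero
    coefficient of exponent at most 1 decides the sign. *)
Lemma FRle_total X Y : FRle X Y \/ FRle Y X.
Proof.
have [L _ h] := Rot_expansion (RotB (Rot_rep Y) (Rot_rep X)).
have [g|g] := gsum_total (const_coefs L) 0; [left|right]; apply/FRleP/le_lo_sub.
  apply: le_lo_congr g; last exact: loC.
  by apply: lo_eq (@lo0 R); apply: nearW => t; rewrite subrr.
case: g => z hz H; exists (fun t => z t + ((rep Y t - rep X t) - gsum (const_coefs L) 0 t)).
  exact: loD.
by apply: filterS H => t; lra.
Qed.

End FermatReals.

Lemma open_setX (T U : topologicalType) (P : set T) (Q : set U) :
  open P -> open Q -> open (P `*` Q).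
Proof.
move=> oP oQ; rewrite (_ : P `*` Q = (fst @^-1` P) `&` (snd @^-1` Q))//.
by apply: openI; apply: open_comp => // z _; [exact: cvg_fst|exact: cvg_snd].
Qed.

(** * Normal forms of smooth functions *)

Section Slices.
Variables (R : realType) (U V : normedModType R).
Implicit Types (B : U * V -> R) (p : U) (y v : V).

Lemma slice_quotient B p y v :
  (fun h : R => h^-1 *: (((fun y => B (p, y)) \o shift y) (h *: v) - B (p, y))) =
  (fun h : R => h^-1 *: ((B \o shift (p, y)) (h *: (0, v)) - B (p, y))).
Proof.
apply/funext => h /=; congr (_ *: (B _ - _)); apply/pair_equal_spec; split=> //=.
by rewrite scaler0 add0r.
Qed.

Lemma derive_slice B p y v : 'D_v (fun y => B (p, y)) y = 'D_(0, v) B (p, y).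
Proof. by rewrite /derive slice_quotient. Qed.

Lemma derivable_slice B p y v :
  derivable B (p, y) (0, v) -> derivable (fun y => B (p, y)) y v.
Proof. by rewrite /derivable slice_quotient. Qed.

Lemma Cinf_slice (P : set U) (W : set V) B p : P p -> Cinf (P `*` W) B ->
  Cinf W (fun y => B (p, y)).
Proof.
move=> Pp CB k; elim: k B CB => [|k IH] B CB.
  split=> // y Wy; have Cy := Cinf_cont CB (conj Pp Wy : (P `*` W) (p, y)).
  apply: (@continuous_comp _ _ _ (fun y => (p, y)) B) => //.
  by apply: cvg_pair => /=; [exact: cvg_cst|exact: cvg_id].
split; first by move=> y Wy; exact: (Ck_cont (IH B CB) Wy).
split=> [y v Wy|v].
  by apply: derivable_slice; apply: (Cinf_derivable CB); split.
rewrite (_ : 'D_v _ = fun y => 'D_(0, v) B (p, y)).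
  exact: (IH _ (Cinf_derive _ CB)).
by apply/funext => y; rewrite derive_slice.
Qed.

End Slices.

Lemma is_derive_bigsum (R : realType) (E : normedModType R) (I : Type) (s : seq I)
    (f : I -> E -> R) (df : I -> R) (x v : E) :
  (forall i, is_derive x v (f i) (df i)) ->
  is_derive x v (fun y => \sum_(i <- s) f i y) (\sum_(i <- s) df i).
Proof.
move=> H; elim: s => [|i s IH].
  by rewrite big_nil; under eq_fun do rewrite big_nil; exact: is_derive_cst.
by rewrite big_cons; under eq_fun do rewrite big_cons; exact: is_deriveD.
Qed.

Section NormalForm.
Variable R : realType.
Implicit Types (J S : set (FR R)) (F : FR R -> FR R) (X Y : FR R)
  (V : set R) (L : seq (R * (R -> R))).

(** The second component stays 0: only the parameters contribute a displacement, while the variable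
    is left to the base path. *)
Lemma fermat_param d (p : 'I_d -> FR R) :
  fermat_path (fun t => ((\row_i rep (p i) t : 'rV[R]_d), 0) : 'rV[R]_d * R).
Proof.
have h := fermat_path_sum (index_enum 'I_d) (fun i : 'I_d =>
   fermat_pathZ ((delta_mx 0 i, 0) : 'rV[R]_d * R) (Rot_rep (p i))).
rewrite (_ : (fun _ => _) = (fun t : R => \sum_(i < d) rep (p i) t *: ((delta_mx 0 i, 0) : 'rV[R]_d * R))) //.
apply/funext => t.
rewrite [RHS]surjective_pairing; apply/pair_equal_spec; split.
  rewrite raddf_sum/= [LHS]row_sum_delta; apply: eq_bigr => i _.
  by rewrite mxE.
rewrite raddf_sum/= big1// => i _; exact: scaler0.
Qed.

Lemma fermat_param_pair d (p : 'I_d -> FR R) Y :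
  fermat_path (fun t => ((\row_i rep (p i) t : 'rV[R]_d), rep Y t) : 'rV[R]_d * R).
Proof.
have h := fermat_pathD (fermat_param p) (fermat_pathZ ((0, 1) : 'rV[R]_d * R) (Rot_rep Y)).
rewrite (_ : (fun _ => _) = fun t => ((\row_i rep (p i) t, 0) : 'rV[R]_d * R) + rep Y t *: ((0, 1) : 'rV[R]_d * R))//.
apply/funext => t; apply/pair_equal_spec; split=> /=.
  by rewrite scaler0 addr0.
by rewrite add0r -[RHS]/(_ * _) mulr1.
Qed.

(** [expansion] is used with base path [(std_vec p, y t)] and the displacement of the parameters, in
    direction [(0, 1)]. The coefficients then depend on the real variable alone, and the derivative
    is expanded by their derivatives. *)
Lemma separate_params d (P : set 'rV[R]_d) V (p : 'I_d -> FR R)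
    (al : 'rV[R]_d -> R -> R) : open P -> open V -> P (std_vec p) ->
  Cinf (P `*` V) (fun z : 'rV[R]_d * R => al z.1 z.2) ->
  exists2 L, smooth_coefs V L & forall (y : R -> R) (y0 : R), V y0 -> y @ 0^'+ --> y0 ->
    lo (fun t => al (\row_i rep (p i) t) (y t) - gsum L (y t) t) /\
    lo (fun t => derive1 (al (\row_i rep (p i) t)) (y t) - gsum (dcoefs (1 : R) L) (y t) t).
Proof.
move=> oP oV Pp CA; set A := fun z : 'rV[R]_d * R => al z.1 z.2 in CA.
have oW : open (P `*` V) by exact: open_setX.
have [l gl pE] := fermat_param p.
have [L' sL' hL'] := expansion ((0, 1) : 'rV[R]_d * R) oW gl CA.
pose L : seq (R * (R -> R)) := [seq (q.1, fun y => q.2 (std_vec p, y)) | q <- L'].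
exists L.
  move=> q /mapP[q' /sL'[e0 C] ->]/=; split=> //.
  exact: (Cinf_slice Pp C).
move=> y y0 Vy yc.
have zc : (fun t => (std_vec p, y t)) @ 0^'+ --> (std_vec p, y0).
  have c1 : (fun _ : R => std_vec p) @ 0^'+ --> std_vec p by exact: cvg_cst.
  exact: cvg_pair c1 yc.
have [h1 h2] := hL' _ (std_vec p, y0) (conj Pp Vy) zc.
have path t : 0 < t -> ((\row_i rep (p i) t : 'rV[R]_d), y t) = (std_vec p, y t) + steps l t.
  move=> /ltW/pE/pair_equal_spec[e1 e2]; apply/pair_equal_spec; split; first exact: e1.
  by move: e2 => /= e2; rewrite -[LHS]addr0 [X in _ + X]e2 add0r.
split.
  apply: lo_eq h1; apply: filterS (near0r_gt0 R) => t /path <-.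
  by rewrite /gsum big_map.
apply: lo_eq h2; apply: filterS (near0r_gt0 R) => t /path <-.
rewrite /gsum /dcoefs !big_map derive1E -(derive_slice A) /=; congr (_ - _).
by apply: eq_bigr => q _ /=; rewrite -(derive_slice q.2).
Qed.

Definition evalFR L Y : FR R := mkFR (fun t => gsum L (rep Y t) t).

Lemma smooth_dcoefs V L : smooth_coefs V L -> smooth_coefs V (dcoefs (1 : R) L).
Proof. by move=> sL q /mapP[q' /sL[e0 C] ->]/=; split=> //; exact: Cinf_derive. Qed.

Lemma Rot_ext d (P : set 'rV[R]_d) V (p : 'I_d -> FR R) (al : 'rV[R]_d -> R -> R) Y :
  open P -> open V -> P (std_vec p) -> V (std Y) ->
  Cinf (P `*` V) (fun z : 'rV[R]_d * R => al z.1 z.2) ->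
  Rot (fun t => al (\row_i rep (p i) t) (rep Y t)) /\
  Rot (fun t => derive1 (al (\row_i rep (p i) t)) (rep Y t)).
Proof.
move=> oP oV Pp VY CA; have oW : open (P `*` V) by exact: open_setX.
have fp := fermat_param_pair p Y.
split; first exact: (Rot_smooth oW CA fp (conj Pp VY)).
have := Rot_smooth oW (Cinf_derive ((0, 1) : 'rV[R]_d * R) CA) fp (conj Pp VY).
rewrite (_ : (fun _ => _) = (fun t => derive1 (al (\row_i rep (p i) t)) (rep Y t)))//.
apply/funext => t; rewrite derive1E.
by rewrite -(derive_slice (fun z : 'rV[R]_d * R => al z.1 z.2)).
Qed.

Lemma ext_separate d (P : set 'rV[R]_d) V (p : 'I_d -> FR R)
    (al : 'rV[R]_d -> R -> R) : open P -> open V -> P (std_vec p) ->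
  Cinf (P `*` V) (fun z : 'rV[R]_d * R => al z.1 z.2) ->
  exists2 L, smooth_coefs V L & forall Y, V (std Y) ->
    ext al p Y = evalFR L Y /\
    ext (fun q y => derive1 (al q) y) p Y = evalFR (dcoefs (1 : R) L) Y.
Proof.
move=> oP oV Pp CA; have [L sL hL] := separate_params oP oV Pp CA.
exists L => // Y VY.
have [h1 h2] := hL (rep Y) (std Y) VY (Rot_cvg (Rot_rep Y)).
have sdL := smooth_dcoefs sL.
have [r1 r2] := Rot_ext oP oV Pp VY CA.
split; apply/mkFR_eq => //.
- exact: (Rot_gsum_comp oV sL (Rot_rep Y) VY).
- exact: (Rot_gsum_comp oV sdL (Rot_rep Y) VY).
Qed.

Definition normal_form J F X V L : Prop :=
  [/\ open V, V (std X), smooth_coefs V L &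
      forall Y, V (std Y) -> J Y -> F Y = evalFR L Y].

Lemma local_rep_normal_form J F X V d P p (al : 'rV[R]_d -> R -> R) :
  local_rep J F X V P p al -> exists2 L, normal_form J F X V L &
    ext (fun q y => derive1 (al q) y) p X = evalFR (dcoefs (1 : R) L) X.
Proof.
move=> [oV [VX [oP [Pp [CA FE]]]]].
have [L sL hL] := ext_separate oP oV Pp CA.
exists L; last by have [] := hL X VX.
by split=> // Y VY JY; rewrite FE//; have [] := hL Y VY.
Qed.

Lemma smooth_normal_form J F X : FRsmooth J F -> J X -> exists V L, normal_form J F X V L.
Proof.
move=> sF /sF[V [d [P [p [al /local_rep_normal_form[L nL _]]]]]].
by exists V, L.
Qed.

Lemma deriv_normal_form J F X Z : FRderiv_is J F X Z ->
  exists V L, normal_form J F X V L /\ Z = evalFR (dcoefs (1 : R) L) X.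
Proof.
case=> V [d [P [p [al [/local_rep_normal_form[L nL dE] ->]]]]].
by exists V, L.
Qed.

(** A normal form is itself a local representation: the classes of the powers t^(e i) serve as
    parameters, and [al] is the linear combination of the coefficient functions with these
    parameters as weights. *)
Lemma normal_form_deriv J F X V L : normal_form J F X V L ->
  FRderiv_is J F X (evalFR (dcoefs (1 : R) L) X).
Proof.
case=> oV VX sL FE; pose d0 : R * (R -> R) := (0, fun=> 0).
pose d := size L; pose e (i : 'I_d) := (nth d0 L i).1; pose u (i : 'I_d) := (nth d0 L i).2.
have sLi i : 0 <= e i /\ Cinf V (u i) by apply: sL; exact: mem_nth.
pose p (i : 'I_d) : FR R := mkFR (fun t => t `^ e i).
pose al (q : 'rV[R]_d) (y : R) := \sum_(i < d) q 0 i * u i y.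
(* Stated for arbitrary coefficient functions [f], since it serves for the [u i] and for their
   derivatives. *)
have alE (M : seq (R * (R -> R))) (f : 'I_d -> R -> R) Y :
    gsum M = (fun y t => \sum_(i < d) t `^ e i * f i y) ->
    (forall i, Cinf V (f i)) -> smooth_coefs V M -> V (std Y) ->
    ext (fun q y => \sum_(i < d) q 0 i * f i y) p Y = evalFR M Y.
  move=> ME Cf sM VY; have Rf i : Rot (fun t => f i (rep Y t)).
    exact: (Rot_smooth oV (Cf i) (Rot_path (Rot_rep Y)) VY).
  apply/mkFR_eq.
  - apply: Rot_sum => i; apply: RotM => //.
    by under eq_fun do rewrite mxE; exact: Rot_rep.
  - exact: (Rot_gsum_comp oV sM (Rot_rep Y) VY).
  - rewrite ME; under eq_fun do rewrite -sumrB.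
    (* The chosen representative of [p i] equals t^(e i) only up to o(t); this error is multiplied
       by a convergent factor. *)
    have h (s : seq 'I_d) : lo (fun t => \sum_(i <- s) ((\row_i rep (p i) t) 0 i * f i (rep Y t) -
        t `^ e i * f i (rep Y t))).
      elim: s => [|i s IH]; first by under eq_fun do rewrite big_nil; exact: lo0.
      under eq_fun do rewrite big_cons; apply: loD IH.
      apply: lo_eq (loMc (Rot_cvg (Rf i)) (rep_mkFR (Rot_pow (sLi i).1))).
      by apply: nearW => t; rewrite mxE mulrBr !(mulrC (f i _)).
    exact: h.
have gE : gsum L = (fun y t => \sum_(i < d) t `^ e i * u i y).
  by apply/funext => y; apply/funext => t; rewrite /gsum (big_nth d0) big_mkord.
have gdE : gsum (dcoefs (1 : R) L) = (fun y t => \sum_(i < d) t `^ e i * 'D_1 (u i) y).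
  apply/funext => y; apply/funext => t.
  by rewrite /gsum /dcoefs big_map (big_nth d0) big_mkord.
have Cu i : Cinf V (u i) := (sLi i).2.
have oT : open [set: 'rV[R]_d] by exact: openT.
have CA : Cinf (setT `*` V) (fun z : 'rV[R]_d * R => al z.1 z.2).
  have oW : open ([set: 'rV[R]_d] `*` V) by exact: open_setX.
  apply: Cinf_sum => // i; apply: CinfM => //.
    apply: (Cinf_fst (f := fun q : 'rV[R]_d => q 0 i)) => //.
      by move=> q; exact: coord_continuous.
    by move=> a x y; rewrite !mxE.
  apply: (Cinf_comp oW _ (Cu i)); first by move=> z [].
  by apply: (Cinf_snd (f := id)) => // x; exact: cvg_id.
exists V, d, setT, p, al; split.
  split=> //; split=> //; split=> //; split=> //; split=> //.
  by move=> Y VY JY; rewrite FE// -(alE L u).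
have CDu i : Cinf V (fun y => 'D_1 (u i) y) by exact: (Cinf_derive (1 : R) (Cu i)).
rewrite -(alE _ (fun i y => 'D_1 (u i) y)) //; last exact: smooth_dcoefs.
apply/mkFR_eq.
- apply: Rot_sum => i; apply: RotM.
    by under eq_fun do rewrite mxE; exact: Rot_rep.
  exact: (Rot_smooth oV (CDu i) (Rot_path (Rot_rep X)) VX).
- exact: (Rot_ext oT oV I VX CA).2.
apply: lo_eq (@lo0 R); near=> t; apply/eqP; rewrite subr_eq0; apply/eqP.
have Vt : V (rep X t) by near: t; exact: (path_in oV VX (Rot_cvg (Rot_rep X))).
rewrite derive1E; apply/esym; apply: derive_val.
apply: is_derive_bigsum => i.
have h : is_derive (rep X t) (1 : R) (u i) ('D_1 (u i) (rep X t)).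
  by apply/derivableP; exact: (Cinf_derivable (Cu i) Vt).
exact: is_deriveZ.
Unshelve. all: by end_near. Qed.

End NormalForm.

(** * Comparison of increments *)

Section Comparison.
Variable R : realType.
Implicit Types (J S : set (FR R)) (F G f g : FR R -> FR R) (X Y a b : FR R)
  (V : set R) (L : seq (R * (R -> R))).

(** Taylor's formula of order 1 for each coefficient. It allows a representative to be exchanged for
    an explicit path of the same class. *)
Lemma gsum_lipschitz V L (x y : R -> R) (x0 : R) : open V -> smooth_coefs V L -> V x0 ->
  x @ 0^'+ --> x0 -> y @ 0^'+ --> x0 -> lo (fun t => x t - y t) ->
  lo (fun t => gsum L (x t) t - gsum L (y t) t).
Proof.
move=> oV + Vx xc yc h; elim: L => [|p L IH] sL.
  by apply: lo_eq (@lo0 R); apply: nearW => t; rewrite /gsum !big_nil subrr.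
have [p0 Cp] := sL p (mem_head _ _).
have h1 : lo (fun t => p.2 (x t) - p.2 (y t)).
  apply: lo_eq (lo_Taylor oV (1 : R) (N := 1) Cp Vx yc (lo_cvg h) h).
  apply: nearW => t; rewrite big_ord1 expr0 fact0 invr1 !mulr1/=; congr (p.2 _ - _).
  by rewrite -[_ *: 1]/(_ * _) mulr1 addrC subrK.
have [l pl] := pow_cvg p0.
have h2 := loD (loMc pl h1) (IH (fun q qL => sL q (mem_behead (s := p :: L) qL))).
by apply: lo_eq h2; apply: nearW => t; rewrite /gsum !big_cons; ring.
Qed.

Local Notation E3 := ((R * R) * R)%type.

Definition affine (z : E3) : R := z.1.1 + z.2 * z.1.2.

Lemma Cinf_affine (W : set E3) : open W -> Cinf W affine.
Proof.
move=> oW; apply: CinfD => //.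
  apply: (Cinf_fst (f := fun q : R * R => q.1)) => //.
  by move=> x; exact: cvg_fst.
apply: CinfM => //.
  by apply: (Cinf_snd (f := id)) => // x; exact: cvg_id.
apply: (Cinf_fst (f := fun q : R * R => q.2)) => //.
by move=> x; exact: cvg_snd.
Qed.

Lemma segment_path (x d : R -> R) : Rot x -> Rot d ->
  exists2 l, good_steps l & forall t, 0 <= t -> forall s : R,
    (((x t, d t), s) : E3) = ((x 0, d 0), s) + steps l t.
Proof.
move=> rx rd.
have [l gl E] := fermat_pathD (fermat_pathZ (((1, 0), 0) : E3) rx)
  (fermat_pathZ (((0, 1), 0) : E3) rd).
exists l => // t t0 s.
have eq u : (((x u, d u), s) : E3) = ((0, 0), s) + (x u *: (((1, 0), 0) : E3) + d u *: (((0, 1), 0) : E3)).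
  apply/pair_equal_spec; split; [apply/pair_equal_spec; split|] => /=.
  - by rewrite -[x u *: 1]/(_ * _) -[d u *: 0]/(_ * _); ring.
  - by rewrite -[x u *: 0]/(_ * _) -[d u *: 1]/(_ * _); ring.
  - by rewrite -[x u *: 0]/(_ * _) -[d u *: 0]/(_ * _); ring.
by rewrite (eq t) (eq 0) E// addrA.
Qed.

(** The point [((x t, d t), s)] is expanded around its position at [t = 0], so that the coefficients
    become functions of [s]. Differentiation in the direction of [s] gives their derivatives and, by
    the chain rule [dA], the factor [d t]. *)
Lemma segment_expansion (x d : R -> R) V L : open V -> smooth_coefs V L -> Rot x -> Rot d ->
  exists M : seq (R * (R -> R)), forall s, V (x 0 + s * d 0) ->
  [/\ derivable_coefs M s,
      lo (fun t => gsum L (x t + s * d t) t - gsum M s t) &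
      lo (fun t => d t * gsum (dcoefs (1 : R) L) (x t + s * d t) t
                   - gsum (dcoefs (1 : R) M) s t)].
Proof.
move=> oV sL rx rd; pose W : set E3 := affine @^-1` V; pose y : E3 := ((0, 0), 1).
have oW : open W.
  apply: open_comp => // z _.
  exact: (Cinf_cont (Cinf_affine (@openT E3)) I).
have [l gl lE] := segment_path rx rd.
have dA (u : R -> R) (z : E3) : Cinf V u -> W z ->
    'D_y (fun z => u (affine z)) z = z.1.2 * 'D_1 u (affine z).
  move=> Cu Wz; case: z Wz => [[z1 z2] s] Wz.
  rewrite -[y]/((0 : R * R), 1) -(derive_slice (fun z => u (affine z))) /affine/=.
  have h1 : is_derive s (1 : R) (fun s => z1 + s * z2) z2.
    have -> : (fun s => z1 + s * z2) = cst z1 + z2 \*: (@id R).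
      by apply/funext => r /=; rewrite mulrC.
    by apply: is_derive_eq; rewrite add0r -[LHS]/(_ * _) mulr1.
  have h2 : is_derive (z1 + s * z2) (1 : R) u ('D_1 u (z1 + s * z2)).
    by apply/derivableP; exact: (Cinf_derivable Cu Wz).
  have h3 := @is_derive1_comp R u (fun s => z1 + s * z2) s _ _ h2 h1.
  by rewrite (@derive_val _ _ _ _ _ _ _ h3) mulrC.
have [B sB hB] : expands W y
   (fun z t => gsum L (affine (z t + steps l t)) t)
   (fun z t => (z t + steps l t).1.2 * gsum (dcoefs (1 : R) L) (affine (z t + steps l t)) t).
  elim: L sL => [|p L IH] sL.
    apply: expands_congr (expands0 W y) => z z0 _ _.
    split; apply: lo_eq (@lo0 R); apply: nearW => t; rewrite /gsum big_nil ?mulr0 subrr//.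
  have [p0 Cp] := sL p (mem_head _ _).
  have CA : Cinf W (fun z => p.2 (affine z)) by exact: (Cinf_comp oW _ Cp (Cinf_affine oW)).
  have h := expandsZ oW 1 p0 (expansion y oW gl CA).
  have {}IH := IH (fun q qL => sL q (mem_behead (s := p :: L) qL)).
  apply: expands_congr (expandsD h IH) => z z0 Wz zz; split; apply: lo_eq (@lo0 R).
    by apply: nearW => t; rewrite /gsum big_cons mul1r subrr.
  have zc : (fun t => z t + steps l t) @ 0^'+ --> z0 + 0 by exact: (cvgD zz (steps_cvg gl)).
  rewrite addr0 in zc; near=> t.
  have Wt : W (z t + steps l t) by near: t; exact: path_in zc.
  by rewrite (dA p.2) ///gsum/= big_cons/=; ring.
exists [seq (q.1, fun s => q.2 ((x 0, d 0), s)) | q <- B] => s Vs.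
have Ws : W ((x 0, d 0), s) by [].
split.
- move=> q /mapP[q' /sB[_ Cq] ->]/=; apply: derivable_slice.
  exact: (Cinf_derivable Cq Ws).
- have [h _] := hB (fun=> ((x 0, d 0), s)) _ Ws (cvg_cst _).
  apply: lo_eq h; apply: filterS (near0r_gt0 R) => t /ltW t0.
  by rewrite -lE// /gsum big_map.
- have [_ h] := hB (fun=> ((x 0, d 0), s)) _ Ws (cvg_cst _).
  apply: lo_eq h; apply: filterS (near0r_gt0 R) => t /ltW t0.
  rewrite -lE// /gsum /dcoefs !big_map/=; congr (_ - _).
  by apply: eq_bigr => q _ /=; rewrite -(derive_slice q.2).
Unshelve. all: by end_near. Qed.

Lemma smooth_coefs_neg V L : open V -> smooth_coefs V L -> smooth_coefs V (neg_coefs L).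
Proof.
move=> oV sL q /mapP[p /sL[p0 Cp] ->]/=; split=> //.
apply: Cinf_ext (CinfM oV (Cinf_cst (-1) oV) Cp) => // x _; exact: mulN1r.
Qed.

Lemma smooth_coefs_cat V L1 L2 : smooth_coefs V L1 -> smooth_coefs V L2 ->
  smooth_coefs V (L1 ++ L2).
Proof. by move=> h1 h2 p; rewrite mem_cat => /orP[/h1|/h2]. Qed.

Lemma smooth_coefs_sub V V' L : V' `<=` V -> smooth_coefs V L -> smooth_coefs V' L.
Proof. by move=> VV sL p /sL[p0 Cp]; split=> //; exact: Cinf_sub Cp. Qed.

Lemma gsum_dcoefs_neg V L (z t : R) : smooth_coefs V L -> V z ->
  gsum (dcoefs (1 : R) (neg_coefs L)) z t = - gsum (dcoefs (1 : R) L) z t.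
Proof.
move=> sL Vz; rewrite /gsum !big_map -sumrN big_seq [RHS]big_seq.
apply: eq_bigr => p /sL[_ Cp] /=; rewrite -mulrN; congr (_ * _).
rewrite (_ : (fun x => - p.2 x) = - p.2)// deriveN//.
exact: (Cinf_derivable Cp Vz).
Qed.

Lemma rep_evalFR V L Y : open V -> smooth_coefs V L -> V (std Y) ->
  lo (fun t => rep (evalFR L Y) t - gsum L (rep Y t) t).
Proof. by move=> oV sL VY; apply: rep_mkFR; exact: (Rot_gsum_comp oV sL (Rot_rep Y)). Qed.

(* Both increments are read off the real family s |-> G(a + s (b - a)) - F(a + s (b - a)), so
   that no subtraction on Fermat reals is needed. *)
Theorem compare_increments J F G f g a b :
  (forall X, FRcc a b X -> J X) -> FRle a b ->
  (forall X, FRcc a b X ->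
     [/\ FRderiv_is J F X (f X), FRderiv_is J G X (g X) & FRle (f X) (g X)]) ->
  le_lo (fun t => rep (G a) t - rep (F a) t) (fun t => rep (G b) t - rep (F b) t).
Proof.
move=> abJ ab H.
have rd := RotB (Rot_rep b) (Rot_rep a); have ra := Rot_rep a.
pose xs (s t : R) := rep a t + s * (rep b t - rep a t).
have rxs s : Rot (xs s) by apply: RotD => //; apply: RotM => //; exact: Rot_cst.
pose Y s : FR R := mkFR (xs s).
have Y0 : Y 0 = a.
  rewrite -[RHS]mkFR_rep; congr mkFR; apply/funext => t.
  by rewrite /xs mul0r addr0.
have Y1 : Y 1 = b.
  rewrite -[RHS]mkFR_rep; congr mkFR; apply/funext => t.
  by rewrite /xs mul1r addrC subrK.
have d0 : le_lo (fun=> 0) (fun t => rep b t - rep a t) by apply: (le_lo_sub _ _).1; apply/FRleP.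
have Yab s : 0 <= s <= 1 -> FRcc a b (Y s).
  move=> /andP[s0 s1]; have [z hz Hz] := d0.
  have nz (c : R) : lo (fun t => c * z t).
    by apply: (@lo_le _ `|c|) hz; apply: nearW => t; rewrite normrM.
  have le1 : FRle (mkFR (rep a)) (Y s).
    apply/FRle_mkFR => //; exists (fun t => s * z t) => //.
    by apply: filterS Hz => t /=; rewrite /xs => h; nra.
  have le2 : FRle (Y s) (mkFR (rep b)).
    apply/FRle_mkFR => //; first exact: Rot_rep.
    exists (fun t => (1 - s) * z t) => //.
    by apply: filterS Hz => t /=; rewrite /xs => h; nra.
  by rewrite !mkFR_rep in le1 le2.
have Yc s : lo (fun t => rep (Y s) t - xs s t) by exact: rep_mkFR.
have Ystd s : std (Y s) = xs s 0 by exact: std_mkFR.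
have xsc s : xs s @ 0^'+ --> xs s 0 by exact: Rot_cvg.
have Yxc s : rep (Y s) @ 0^'+ --> xs s 0 by rewrite -Ystd; exact: Rot_cvg (Rot_rep _).
rewrite -{1 2}Y0 -{1 2}Y1.
apply: (@family_mono R (fun s t => rep (G (Y s)) t - rep (F (Y s)) t)) => s s01.
have JY := Yab s s01; have [dF dG fg] := H _ JY.
have [V1 [L1 [[oV1 VY1 sL1 FE] fE]]] := deriv_normal_form dF.
have [V2 [L2 [[oV2 VY2 sL2 GE] gE]]] := deriv_normal_form dG.
(* On [V] the list [L] describes the difference of [G] and [F]. *)
pose V := V1 `&` V2; pose L := L2 ++ neg_coefs L1.
have oV : open V by exact: openI.
have {}sL1 : smooth_coefs V L1 by apply: smooth_coefs_sub sL1 => z [].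
have {}sL2 : smooth_coefs V L2 by apply: smooth_coefs_sub sL2 => z [].
have sL : smooth_coefs V L by apply: smooth_coefs_cat => //; exact: smooth_coefs_neg.
have VYs : V (xs s 0) by rewrite -Ystd.
have [M hM] := segment_expansion oV sL ra rd.
have Vnear : \forall s' \near s, V (xs s' 0).
  have c : (fun s' => xs s' 0) @ s --> xs s 0.
    by apply: cvgD; [exact: cvg_cst|apply: cvgM; [exact: cvg_id|exact: cvg_cst]].
  by apply: (c V); exact: open_nbhs_nbhs.
have [_ _ hMd] := hM s VYs.
exists M; split.
- by apply: filterS Vnear => s' /hM[].
- apply: filterS Vnear => s' Vs' s'01; have [_ h _] := hM s' Vs'.
  have [V1s V2s] : V1 (std (Y s')) /\ V2 (std (Y s')) by rewrite Ystd.
  have JYs := abJ _ (Yab s' s'01).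
  have Vstd : V (std (Y s')) by [].
  rewrite FE// GE//.
  have l1 := rep_evalFR oV sL1 Vstd; have l2 := rep_evalFR oV sL2 Vstd.
  have k1 := gsum_lipschitz oV sL1 Vs' (Yxc s') (xsc s') (Yc s').
  have k2 := gsum_lipschitz oV sL2 Vs' (Yxc s') (xsc s') (Yc s').
  have := loD (loB (loD l2 k2) (loD l1 k1)) h.
  apply: lo_eq; apply: nearW => t; rewrite gsum_cat gsum_neg /xs; ring.
- move: fg; rewrite fE gE => /FRleP fg0; have fg := (le_lo_sub _ _).1 fg0.
  have sdL1 := smooth_dcoefs sL1; have sdL2 := smooth_dcoefs sL2.
  have Vstd : V (std (Y s)) by [].
  have l1 := rep_evalFR oV sdL1 Vstd; have l2 := rep_evalFR oV sdL2 Vstd.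
  have k1 := gsum_lipschitz oV sdL1 VYs (Yxc s) (xsc s) (Yc s).
  have k2 := gsum_lipschitz oV sdL2 VYs (Yxc s) (xsc s) (Yc s).
  (* The derivative of the family along the segment is b - a times the difference of the
     derivatives, a product of two factors that are nonnegative modulo o(t). *)
  have nn := le_lo_mul (Rot_cvg rd) (Rot_cvg (RotB (Rot_rep _) (Rot_rep _))) d0 fg.
  apply: le_lo_congr _ _ nn.
    by apply: lo_eq (@lo0 R); apply: nearW => t; rewrite subrr.
  apply: lo_trans _ hMd.
  have kk := loMc (Rot_cvg rd) (loB (loD l2 k2) (loD l1 k1)).
  apply: lo_eq kk; near=> t.
  have Vt : V (xs s t) by near: t; exact: (path_in oV VYs (xsc s)).
  rewrite -/(xs s t) /L /dcoefs map_cat gsum_cat -!/(dcoefs _ _).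
  by rewrite (gsum_dcoefs_neg _ sL1 Vt); ring.
Unshelve. all: by end_near. Qed.

Corollary compare J F G f g a b :
  (forall X, FRcc a b X -> J X) -> FRle a b ->
  (forall X, FRcc a b X ->
     [/\ FRderiv_is J F X (f X), FRderiv_is J G X (g X) & FRle (f X) (g X)]) ->
  F a = G a -> FRle (F b) (G b).
Proof.
move=> abJ ab H Fa; apply/FRleP; apply: (le_lo_sub _ _).2.
apply: le_lo_congr _ _ (compare_increments abJ ab H); rewrite ?Fa;
  apply: lo_eq (@lo0 R); apply: nearW => t; rewrite subrr ?subr0//.
Qed.

End Comparison.

(** * Existence of primitives *)

Section Antiderivative.
Variable R : realType.
Implicit Types (u : R -> R) (V : set R) (L : seq (R * (R -> R))).

Definition rball (c r : R) : set R := [set x | `|x - c| < r].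

Lemma open_rball (c r : R) : open (rball c r).
Proof.
rewrite (_ : rball c r = ball c r); first exact: ball_open.
by apply/seteqP; split=> x; rewrite /rball /ball/= distrC.
Qed.

Lemma open_between (c d : R) : open [set x | c < x < d].
Proof.
rewrite (_ : [set x | _] = [set` `]c, d[]); first exact: itv_open.
by apply/seteqP; split=> x; rewrite /= in_itv.
Qed.

(** The closed ball lies in [V], so [u] is continuous on the compact segment and can be integrated
    from [c - r]; the fundamental theorem gives the derivative at interior points, hence the open
    ball in the conclusion. *)
Lemma antiderivative V u (c r : R) : (forall x, `|x - c| <= r -> V x) -> Cinf V u -> 0 < r ->
  exists U, forall x, rball c r x -> is_derive x (1 : R) U (u x).
Proof.
move=> rV Cu r0; pose mu := @lebesgue_measure R.
have cc : {within `[c - r, c + r], continuous u}.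
  apply: continuous_in_subspaceT => x; rewrite inE/= in_itv/= => /andP[x1 x2].
  apply: (Cinf_cont Cu); apply: rV.
  by rewrite ler_norml; apply/andP; split; lra.
have iu : mu.-integrable `[c - r, c + r] (EFin \o u).
  by apply: continuous_compact_integrable => //; exact: segment_compact.
exists (fun x => (\int[mu]_(t in [set` `[(c - r), x]]) (u t))%R) => x.
rewrite /rball/= ltr_norml => /andP[x1 x2].
have xu : x < c + r by lra.
have ax : c - r < x by lra.
have cx : {for x, continuous u}.
  by apply: (Cinf_cont Cu); apply: rV; rewrite ler_norml; apply/andP; split; lra.
have [d e] := continuous_FTC1_closed xu iu ax cx.
by split=> //; rewrite -derive1E.
Qed.

Lemma is_derive_dir (U : R -> R) (x v D : R) :
  is_derive x (1 : R) U D -> is_derive x v U (v * D).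
Proof.
case=> /derivable1_diffP dU <-; split; first exact: diff_derivable.
by rewrite !deriveE// -{1}[v]mulr1 -[v * 1]/(v *: (1 : R)) linearZ.
Qed.

Lemma Cinf_antiderivative V (U u : R -> R) : open V -> Cinf V u ->
  (forall x, V x -> is_derive x (1 : R) U (u x)) -> Cinf V U.
Proof.
move=> oV Cu dU k.
have cU x : V x -> {for x, continuous U}.
  move=> /dU[d _]; apply: differentiable_continuous; exact/derivable1_diffP.
case: k => [|k]; first by split.
split=> //; split=> [x v /dU/(is_derive_dir v)[]//|v].
apply: (Ck_ext (f := fun x => v * u x) oV).
  by move=> x /dU/(is_derive_dir v)[_ ->].
exact: (CinfM oV (Cinf_cst v oV) Cu).
Qed.

Lemma antiderivative_coefs V L (c r : R) : (forall x, `|x - c| <= r -> V x) ->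
  0 < r -> smooth_coefs V L ->
  exists2 M, smooth_coefs (rball c r) M &
    forall z t, rball c r z -> gsum (dcoefs (1 : R) M) z t = gsum L z t.
Proof.
move=> rV r0; have obV : rball c r `<=` V by move=> x /ltW/rV.
have oO : open (rball c r) by exact: open_rball.
elim: L => [|p L IH] sL; first by exists [::] => // z t _; rewrite /gsum !big_nil.
have [p0 Cp] := sL p (mem_head _ _).
have [M sM hM] := IH (fun q qL => sL q (mem_behead (s := p :: L) qL)).
have [U hU] := antiderivative rV Cp r0.
exists ((p.1, U) :: M).
  move=> q; rewrite inE => /orP[/eqP->/=|/sM//]; split=> //.
  exact: (Cinf_antiderivative oO (Cinf_sub obV Cp) hU).
move=> z t Oz; rewrite /gsum/= !big_cons/= -/(gsum _ z t) -/(gsum L z t) hM//.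
by have [_ ->] := hU z Oz.
Qed.

Lemma smooth_const_coefs V (D : seq (R * R)) : open V ->
  (forall p, p \in D -> 0 <= p.1) -> smooth_coefs V (const_coefs D).
Proof. by move=> oV hD q /mapP[p /hD p0 ->]/=; split=> //; exact: Cinf_cst. Qed.

Lemma gsum_dcoefs_const (D : seq (R * R)) (z t : R) :
  gsum (dcoefs (1 : R) (const_coefs D)) z t = 0.
Proof. by rewrite /gsum !big_map big1// => p _ /=; rewrite derive_cst mulr0. Qed.

End Antiderivative.

(** * Uniqueness of primitives and gluing *)

Section Existence.
Variable R : realType.
Implicit Types (J : set (FR R)) (F G f g : FR R -> FR R) (X Y Z m : FR R).

Definition FRconvex J := forall X Y Z, J X -> J Z -> FRle X Y -> FRle Y Z -> J Y.

Lemma FRderiv_congr J F G (O : set R) X Z : open O -> O (std X) ->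
  (forall Y, J Y -> O (std Y) -> F Y = G Y) -> FRderiv_is J F X Z -> FRderiv_is J G X Z.
Proof.
move=> oO OX FG [V [d [P [p [al [[oV [VX [oP [Pp [CA FE]]]]] ->]]]]]].
exists (V `&` O), d, P, p, al; split=> //; split; first exact: openI.
split=> //; split=> //; split=> //; split.
  by apply: Cinf_sub CA => z [Pz [Vz _]].
by move=> Y [VY OY] JY; rewrite -FG// FE.
Qed.

Lemma std_le X Y : FRle X Y -> std X <= std Y.
Proof. by move/FRleP/le_lo_cvg; apply; exact: Rot_rep. Qed.

Lemma std_lt X Y : std X < std Y -> FRle X Y.
Proof.
move=> XY; apply/FRleP; exists (fun=> 0); first exact: lo0.
have h : (fun t => rep Y t - rep X t) @ 0^'+ --> std Y - std X.
  by apply: cvgB; exact: Rot_cvg (Rot_rep _).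
have XY0 : 0 < std Y - std X by rewrite subr_gt0.
have : \forall t \near 0^'+, 0 < rep Y t - rep X t by move/cvgr_gt: h => /(_ _ XY0).
by apply: filterS => t; rewrite subr_gt0 addr0 => /ltW.
Qed.

(* The radius r does not depend on the prescribed value W at m, which is what allows gluing. *)
Lemma local_primitive J g X : FRsmooth J g -> J X -> exists2 r, 0 < r &
  forall m W, rball (std X) r (std m) -> exists2 G, G m = W &
    forall Y, J Y -> rball (std X) r (std Y) -> FRderiv_is J G Y (g Y).
Proof.
move=> sg JX; have [V [L [oV VX sL gE]]] := smooth_normal_form sg JX.
have [e e0 eV] : exists2 e, 0 < e & forall x, `|x - std X| < e -> V x.
  have /nbhs_ballP[e e0 eV] : nbhs (std X) V by exact: open_nbhs_nbhs.
  by exists e => // x xe; apply: eV; rewrite /ball/= distrC.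
pose r := e / 2; have r0 : 0 < r by rewrite divr_gt0.
have rV x : `|x - std X| <= r -> V x.
  by move=> xr; apply: eV; apply: (le_lt_trans xr); rewrite ltr_pdivrMr// ltr_pMr// ltr1n.
have obV : rball (std X) r `<=` V by move=> x /ltW/rV.
have [M sM hM] := antiderivative_coefs rV r0 sL.
have oO : open (rball (std X) r) by exact: open_rball.
exists r => // m W Om.
have rM := Rot_gsum_comp oO sM (Rot_rep m) Om.
(* The constant of integration is a Fermat real, not a real: [D] expands the difference between [W]
   and the value of the primitive [M] at [m], and is added as constant coefficients. *)
have [D D0 hD] := Rot_expansion (RotB (Rot_rep W) rM).
pose N := M ++ const_coefs D.
have sN : smooth_coefs (rball (std X) r) N.
  by apply: smooth_coefs_cat => //; exact: smooth_const_coefs.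
exists (evalFR N).
  apply/FR_eq; apply: lo_trans (rep_evalFR oO sN Om) _.
  apply: lo_eq (loN hD); apply: nearW => t; rewrite gsum_cat.
  by rewrite [gsum (const_coefs D) (rep m t) t](_ : _ = gsum (const_coefs D) 0 t)
    ?/gsum ?big_map//; ring.
move=> Y JY OY.
have nf : normal_form J (evalFR N) Y (rball (std X) r) N by split.
have -> : g Y = evalFR (dcoefs (1 : R) N) Y; last exact: normal_form_deriv nf.
rewrite gE//; last exact: obV.
apply/mkFR_eq; [exact: (Rot_gsum_comp oV sL (Rot_rep Y) (obV _ OY))| |].
  exact: (Rot_gsum_comp oO (smooth_dcoefs sN) (Rot_rep Y) OY).
apply: lo_eq (@lo0 R); near=> t.
have Ot : rball (std X) r (rep Y t) by near: t; exact: (path_in oO OY (Rot_cvg (Rot_rep Y))).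
by rewrite /dcoefs map_cat gsum_cat -!/(dcoefs _ _) gsum_dcoefs_const addr0 hM// subrr.
Unshelve. all: by end_near. Qed.

(** Both functions have the derivative [g], so increments can be compared in both orders, by
    reflexivity of the order. If X <= m, the comparison starts at X and is read backwards from the
    common value at m. *)
Lemma primitive_unique J g G1 G2 m X (c d : R) : FRconvex J ->
  (forall Y, J Y -> c < std Y < d -> FRderiv_is J G1 Y (g Y) /\ FRderiv_is J G2 Y (g Y)) ->
  J m -> c < std m < d -> J X -> c < std X < d -> G1 m = G2 m -> G1 X = G2 X.
Proof.
move=> cJ H Jm /andP[cm md] JX /andP[cX Xd] e.
have incr A B (K1 K2 : FR R -> FR R) : J A -> J B -> c < std A -> std B < d -> FRle A B ->
   (forall Y, J Y -> c < std Y < d -> FRderiv_is J K1 Y (g Y) /\ FRderiv_is J K2 Y (g Y)) ->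
   le_lo (fun t => rep (K2 A) t - rep (K1 A) t) (fun t => rep (K2 B) t - rep (K1 B) t).
  move=> JA JB cA Bd AB HK; apply: (@compare_increments R J K1 K2 g g) => // Y [AY YB].
    exact: cJ JA JB AY YB.
  have cYd : c < std Y < d.
    by rewrite (lt_le_trans cA (std_le AY)) (le_lt_trans (std_le YB)).
  by have [? ?] := HK Y (cJ _ _ _ JA JB AY YB) cYd; split=> //; exact: FRle_refl.
have H' Y : J Y -> c < std Y < d -> FRderiv_is J G2 Y (g Y) /\ FRderiv_is J G1 Y (g Y).
  by move=> JY /H-/(_ JY)[].
apply/FR_eq.
have z (K : FR R -> FR R) (A B : FR R) : lo (fun t => (rep (K A) t - rep (K A) t) - 0).
  by apply: lo_eq (@lo0 R); apply: nearW => t; rewrite subrr subr0.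
have z' (A : FR R) (K1 K2 : FR R -> FR R) : K1 A = K2 A -> lo (fun t => (rep (K1 A) t - rep (K2 A) t) - 0).
  by move=> ->; exact: (z K2 A A).
have id x : lo (fun t : R => x t - x t).
  by apply: lo_eq (@lo0 R); apply: nearW => t; rewrite subrr.
have [mX|Xm] := FRle_total m X.
  have h1 := incr _ _ _ _ Jm JX cm Xd mX H.
  have h2 := incr _ _ _ _ Jm JX cm Xd mX H'.
  apply: le_lo_anti; apply: (le_lo_sub _ _).2.
    exact: le_lo_congr (z' m G2 G1 (esym e)) (id _) h1.
  exact: le_lo_congr (z' m G1 G2 e) (id _) h2.
have h1 := incr _ _ _ _ JX Jm cX md Xm H.
have h2 := incr _ _ _ _ JX Jm cX md Xm H'.
have k1 := le_lo_congr (id _) (z' m G2 G1 (esym e)) h1.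
have k2 := le_lo_congr (id _) (z' m G1 G2 e) h2.
have rl (x y : R -> R) : le_lo (fun t => x t - y t) (fun=> 0) -> le_lo x y.
  by move=> [w hw K]; exists w => //; apply: filterS K => t; lra.
by apply: le_lo_anti; apply: rl.
Qed.

Section Glue.
Variables (J : set (FR R)) (g : FR R -> FR R) (a : FR R).
Hypotheses (cJ : FRconvex J) (sg : FRsmooth J g) (Ja : J a).

(** Open sets of the Fermat topology are determined by standard parts, so the domain is given by a
    real interval and its extension becomes an induction on a real [s]. The interval contains
    [std a], where the value is fixed. *)
Definition primitive_to (s : R) : Prop := exists c d G,
  [/\ c < std a < d, c < s < d, G a = FR0 R &
      forall Y, J Y -> c < std Y < d -> FRderiv_is J G Y (g Y)].

Lemma primitive_to_step X : J X -> exists2 r, 0 < r & forall m s, J m ->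
  rball (std X) r (std m) -> rball (std X) r s -> primitive_to (std m) -> primitive_to s.
Proof.
move=> JX; have [r r0 H] := local_primitive sg JX; exists r => // m s Jm Om Os.
case=> c [d [G [/andP[ca ad] /andP[cm md] Ga HG]]].
have [G2 G2m HG2] := H m (G m) Om.
(* [G] is kept on its whole interval; [G2], chosen with the value of [G] at [m], takes over
   outside. *)
pose G' Y := if (c < std Y < d) then G Y else G2 Y.
have obE x : rball (std X) r x <-> std X - r < x < std X + r.
  by rewrite /rball/= ltr_norml; split=> /andP[? ?]; apply/andP; split; lra.
have oI := @open_between R c d.
(* The interval and the ball both contain [std m], so their union is the interval with these
   ends. *)
exists (Num.min c (std X - r)), (Num.max d (std X + r)), G'.
move: (Om) (Os) => /obE/andP[m1 m2] /obE/andP[s1 s2]; split.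
- by rewrite gt_min ca lt_max ad.
- by rewrite gt_min s1 orbT lt_max s2 orbT.
- by rewrite /G' ca ad.
move=> Y JY; rewrite gt_min lt_max => /andP[Y1 Y2].
have [cYd|ncYd] := boolP (c < std Y < d).
  apply: (FRderiv_congr oI cYd _ (HG Y JY cYd)) => Z JZ cZd.
  by rewrite /G' (_ : c < std Z < d).
have OY : rball (std X) r (std Y).
  apply/obE; move: ncYd; rewrite negb_and -!leNgt => /orP[Yc|dY].
    have Y1' : std X - r < std Y by case/orP: Y1 => // ?; lra.
    by rewrite Y1'/=; lra.
  have Y2' : std Y < std X + r by case/orP: Y2 => // ?; lra.
  by rewrite Y2' andbT; lra.
apply: (FRderiv_congr (@open_rball R (std X) r) OY _ (HG2 Y JY OY)) => Z JZ OZ.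
rewrite /G'; case: ifPn => // cZd.
move: (OZ) cZd => /obE/andP[z1 z2] /andP[cz zd].
(* On the overlap, which contains [std m], the two primitives agree because they agree at [m]. *)
apply: (@primitive_unique J g G2 G m Z (Num.max c (std X - r)) (Num.min d (std X + r))) => //.
- move=> W JW; rewrite gt_max lt_min => /andP[/andP[w1 w2] /andP[w3 w4]]; split.
    by apply: HG2 => //; apply/obE; rewrite w2.
  by apply: HG => //; rewrite w1.
- by rewrite gt_max lt_min cm md m1 m2.
- by rewrite gt_max lt_min cz zd z1 z2.
Qed.

Lemma std_convex X Y (s : R) : J X -> J Y -> std X <= s <= std Y -> exists2 Z, J Z & std Z = s.
Proof.
move=> JX JY /andP[]; rewrite le_eqVlt => /orP[/eqP<- _|Xs]; first by exists X.
rewrite le_eqVlt => /orP[/eqP->|sY]; first by exists Y.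
have e : std (mkFR (fun=> s)) = s by rewrite std_mkFR//; exact: Rot_cst.
by exists (mkFR (fun=> s)) => //; apply: (cJ JX JY); apply: std_lt; rewrite e.
Qed.

Lemma primitive_to_all X : J X -> primitive_to (std X).
Proof.
move=> JX.
have base : primitive_to (std a).
  have [r r0 H] := local_primitive sg Ja.
  have Oa : rball (std a) r (std a) by rewrite /rball/= subrr normr0.
  have [G Ga HG] := H a (FR0 R) Oa.
  exists (std a - r), (std a + r), G; split=> //.
  - by apply/andP; split; lra.
  - by apply/andP; split; lra.
  - move=> Y JY /andP[y1 y2]; apply: HG => //.
    by rewrite /rball/= ltr_norml; apply/andP; split; lra.
have [aX|/ltW Xa] := leP (std a) (std X).
  apply: (interval_induction aX _ base) => s sab.
  have [Z JZ <-] := std_convex Ja JX sab.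
  have [r r0 H] := primitive_to_step JZ; exists r => // u v au uv vb us vs.
  have [m Jm mu] : exists2 m, J m & std m = u.
    by apply: (std_convex Ja JX); rewrite au (le_trans uv).
  by rewrite -mu; apply: (H m v); rewrite // /rball /= mu.
(* Interval induction runs to the right only; points left of [a] are reached after the reflection s
   |-> -s. *)
rewrite -[std X]opprK.
have Xa' : - std a <= - std X by rewrite lerN2.
apply: (@interval_induction R (fun s => primitive_to (- s)) _ _ Xa'); last by rewrite opprK.
move=> s /andP[s1 s2].
have [|Z JZ Zs] := @std_convex X a (- s) JX Ja; first by apply/andP; split; lra.
have [r r0 H] := primitive_to_step JZ; exists r => // u v au uv vb us vs.
have [|m Jm mu] := @std_convex X a (- u) JX Ja; first by apply/andP; split; lra.
rewrite -mu; apply: (H m (- v)) => //.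
  by rewrite /rball/= mu Zs -opprD normrN.
by rewrite /rball/= Zs -opprD normrN.
Qed.

Theorem primitive_exists : exists I, is_primitive J g a I.
Proof.
have [Gf hG] : {Gf : FR R -> FR R -> FR R & forall X, J X -> exists c d,
    [/\ c < std a < d, c < std X < d, Gf X a = FR0 R &
        forall Y, J Y -> c < std Y < d -> FRderiv_is J (Gf X) Y (g Y)]}.
  apply: (@choice _ _ (fun X G => J X -> exists c d,
    [/\ c < std a < d, c < std X < d, G a = FR0 R &
        forall Y, J Y -> c < std Y < d -> FRderiv_is J G Y (g Y)])) => X.
  have [JX|nJX] := pselect (J X); last by exists (fun=> FR0 R).
  by have [c [d [G H]]] := primitive_to_all JX; exists G => _; exists c, d.
(* Each point is evaluated in a primitive whose interval reaches it. Near [X] these all agree with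
   [Gf X], by uniqueness from the common value at [a]. *)
pose I X := Gf X X.
have dI X : J X -> FRderiv_is J I X (g X).
  move=> JX; have [c [d [/andP[ca ad] cXd Ga HG]]] := hG X JX.
  have oI := @open_between R c d.
  apply: (FRderiv_congr oI cXd _ (HG X JX cXd)) => Y JY /andP[cY Yd].
  have [c' [d' [/andP[ca' ad'] /andP[cY' Yd'] Ga' HG']]] := hG Y JY.
  apply: (@primitive_unique J g (Gf X) (Gf Y) a Y (Num.max c c') (Num.min d d')) => //.
  - move=> W JW; rewrite gt_max lt_min => /andP[/andP[w1 w2] /andP[w3 w4]].
    by split; [apply: HG => //; rewrite w1|apply: HG' => //; rewrite w2].
  - by rewrite gt_max lt_min ca ca' ad ad'.
  - by rewrite gt_max lt_min cY cY' Yd Yd'.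
  - by rewrite Ga Ga'.
exists I; split; [|split=> //].
- move=> X JX; have [V [d [P [p [al [H _]]]]]] := dI X JX.
  by exists V, d, P, p, al.
- by have [c [d []]] := hG a Ja.
Qed.

End Glue.
End Existence.

(** * The inequality *)

Section AbsoluteValue.
Variable R : realType.
Implicit Types (J : set (FR R)) (F f g : FR R -> FR R) (X Y Z a b : FR R).

Lemma rep_FR0 : lo (rep (FR0 R)).
Proof.
have h : lo (fun t => rep (FR0 R) t - 0).
  apply/cls_eq; [exact: Rot_rep|exact: Rot_cst|].
  by rewrite -(rep_spec (FR0 R)).2.
by apply: lo_eq h; apply: nearW => t; rewrite subr0.
Qed.

Lemma rep_FRopp X : lo (fun t => rep (FRopp X) t - - rep X t).
Proof. by apply: rep_mkFR; apply: RotN; exact: Rot_rep. Qed.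

Lemma FRopp0 : FRopp (FR0 R) = FR0 R.
Proof.
apply/FR_eq; apply: lo_trans (rep_FRopp _) _.
exact: loB (loN rep_FR0) rep_FR0.
Qed.

Lemma FRle_opp X Y : FRle X Y -> FRle (FRopp Y) (FRopp X).
Proof.
move=> /FRleP[z hz H]; apply/FRleP.
apply: le_lo_congr (loC (rep_FRopp Y)) (loC (rep_FRopp X)) _.
by exists z => //; apply: filterS H => t; lra.
Qed.

Lemma FRabs_bounds X : FRle X (FRabs X) /\ FRle (FRopp X) (FRabs X).
Proof.
rewrite /FRabs; case: pselect => h /=.
  split; first exact: FRle_refl.
  have := FRle_opp h; rewrite FRopp0 => h'; exact: FRle_trans h' h.
have X0 : FRle X (FR0 R) by case: (FRle_total (FR0 R) X).
split; last exact: FRle_refl.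
by have := FRle_opp X0; rewrite FRopp0; exact: FRle_trans X0.
Qed.

Lemma FRabs_le X Y : FRle X Y -> FRle (FRopp X) Y -> FRle (FRabs X) Y.
Proof. by rewrite /FRabs; case: pselect. Qed.

Lemma FRderiv_opp J F X Z : J X -> FRderiv_is J F X Z ->
  FRderiv_is J (fun Y => FRopp (F Y)) X (FRopp Z).
Proof.
move=> JX /deriv_normal_form[V [L [[oV VX sL FE] ->]]].
have snL := smooth_coefs_neg oV sL.
have nf : normal_form J (fun Y => FRopp (F Y)) X V (neg_coefs L).
  split=> // Y VY JY; rewrite FE//; apply/FR_eq; apply: lo_trans (rep_FRopp _) _.
  have h1 := rep_evalFR oV sL VY; have h2 := rep_evalFR oV snL VY.
  by apply: lo_eq (loN (loD h1 h2)); apply: nearW => t; rewrite gsum_neg; ring.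
have -> : FRopp (evalFR (dcoefs (1 : R) L) X) = evalFR (dcoefs (1 : R) (neg_coefs L)) X; last first.
  exact: normal_form_deriv nf.
apply/FR_eq; apply: lo_trans (rep_FRopp _) _.
have h1 := rep_evalFR oV (smooth_dcoefs sL) VX; have h2 := rep_evalFR oV (smooth_dcoefs snL) VX.
apply: lo_eq (loN (loD h1 h2)); near=> t.
have Vt : V (rep X t) by near: t; exact: (path_in oV VX (Rot_cvg (Rot_rep X))).
by rewrite (gsum_dcoefs_neg _ sL Vt); ring.
Unshelve. all: by end_near. Qed.

Lemma interval_convex J : nonInf_interval J -> FRconvex J.
Proof.
case=> k [a [b [_ [_ ->]]]] X Y Z.
have lt_l c x y : eFRlt c (Fin x) -> FRle x y -> eFRlt c (Fin y).
  case: c => [c||] [cx ne] xy; split=> //; first exact: FRle_trans cx xy.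
  by case=> cy; apply: ne; congr Fin; apply: FRle_anti; rewrite ?cy in cx *.
have lt_r c x y : eFRlt (Fin y) c -> FRle x y -> eFRlt (Fin x) c.
  case: c => [c||] [yc ne] xy; split=> //; first exact: FRle_trans xy yc.
  by case=> xc; apply: ne; congr Fin; apply: FRle_anti => //; rewrite -xc.
have le_l c x y : eFRle c (Fin x) -> FRle x y -> eFRle c (Fin y).
  by case: c => [c||] //= cx xy; exact: FRle_trans cx xy.
have le_r c x y : eFRle (Fin y) c -> FRle x y -> eFRle (Fin x) c.
  by case: c => [c||] //= yc xy; exact: FRle_trans xy yc.
by case: k => -[h1 _] [_ h2] XY YZ; split;
  [exact: le_l h1 XY|exact: le_r h2 YZ|exact: lt_l h1 XY|exact: lt_r h2 YZ
  |exact: le_l h1 XY|exact: lt_r h2 YZ|exact: lt_l h1 XY|exact: le_r h2 YZ].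
Qed.

Lemma FRintegral_primitive J f a : FRconvex J -> FRsmooth J f -> J a ->
  is_primitive J f a (FRintegral J f a).
Proof.
move=> cJ sf Ja; rewrite /FRintegral /choose_or.
case: pselect => [h|[]]; last exact: primitive_exists.
exact: (proj2_sig (cid h)).
Qed.

End AbsoluteValue.

Theorem theorem30 (R : realType) (J : set (FR R)) (f g : FR R -> FR R) (a b : FR R) :
  nonInf_interval J ->
  FRsmooth J f -> FRsmooth J g ->
  J a -> J b -> FRlt a b ->
  (forall x, FRcc a b x -> FRle (FRabs (f x)) (g x)) ->
  FRle (FRabs (FRintegral J f a b)) (FRintegral J g a b).
Proof.
move=> /interval_convex cJ sf sg Ja Jb [ab _] fg.
have [_ [If0 dIf]] := FRintegral_primitive cJ sf Ja.
have [_ [Ig0 dIg]] := FRintegral_primitive cJ sg Ja.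
have abJ X : FRcc a b X -> J X by move=> [aX Xb]; exact: cJ Ja Jb aX Xb.
apply: FRabs_le.
  apply: (compare (f := f) (g := g) abJ ab); last by rewrite If0 Ig0.
  move=> X Xab; split; [exact/dIf/abJ|exact/dIg/abJ|].
  exact: FRle_trans (FRabs_bounds _).1 (fg X Xab).
(* The negated integral of [f] is compared with the integral of [g] as a primitive of [FRopp (f X)];
   both vanish at [a]. *)
apply: (@compare R J (fun X => FRopp (FRintegral J f a X)) _ (fun X => FRopp (f X)) g a b abJ ab).
  move=> X Xab; split; [|exact/dIg/abJ|].
    by apply: FRderiv_opp; [exact: abJ|exact/dIf/abJ].
  exact: FRle_trans (FRabs_bounds _).2 (fg X Xab).
by rewrite If0 Ig0 FRopp0.
Qed.
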